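(* Let $K$ be a fixed $n\times m$ complex matrix and let $p,q$ be relatively prime integers, $q\ge 1$, such that $p/q\in[-1,2]\setminus\{0\}$. Let $\Upsilon_t(A)=\operatorname{tr}\left[(K^*A^tK)^{1/t}\right]$ for $A\in\mathbf{H}^n_{++}$. \begin{itemize} \item If $t=p/q\in(0,1]$ then $\mathrm{hyp}(t\Upsilon_t)$ has an SDP representation with at most $2\lfloor\log_2(q)\rfloor+1$ LMIs of size $2mn\times 2mn$, one LMI of size $mn\times mn$, and one scalar inequality. \item If $t=p/q\in[-1,0)\cup[1,2]$ then $\mathrm{epi}(t\Upsilon_t)$ has an SDP representation with at most $2\lfloor\log_2(q)\rfloor+2$ LMIs of size $2mn\times 2mn$, one LMI of size $mn\times mn$, and one scalar inequality. \end{itemize}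
   Context: $\mathbf{H}^n$ denotes the space of $n\times n$ complex Hermitian matrices, $\mathbf{H}^n_{++}$ the cone of positive definite ones; $K^*$ is the conjugate transpose; $X\succeq0$ means $X$ is positive semidefinite. $\Upsilon_t$ is regarded as a function $\mathbf{H}^n_{++}\to\mathbb{R}$ (so it is implicit that the expression defining it makes sense; for $t<0$ this means $K^*A^tK$ is invertible). The hypograph and epigraph are $$\mathrm{hyp}(t\Upsilon_t)=\{(A,\tau)\in\mathbf{H}^n_{++}\times\mathbb{R}: t\Upsilon_t(A)\geq\tau\},\qquad \mathrm{epi}(t\Upsilon_t)=\{(A,\tau)\in\mathbf{H}^n_{++}\times\mathbb{R}: t\Upsilon_t(A)\leq\tau\}.$$ A linear matrix inequality (LMI) of size $N$ (or $N\times N$) in real variables $y_1,\dots,y_k$ is a condition $A_0+y_1A_1+\dots+y_kA_k\succeq 0$ with $A_0,\dots,A_k\in\mathbf{H}^N$ fixed; a scalar inequality is an LMI of size $1$. A convex set has a semidefinite programming (SDP) representation (SDP description) if it can be expressed using LMIs, where auxiliary (lifting) variables are allowed: a point $x$ is in the set if and only if there exist auxiliary variables $y$ such that $(x,y)$ satisfies finitely many LMIs. The size of the representation is recorded by the number of LMIs of each size. Convention: matrix variables that are arguments of matrix powers or geometric means (the variable $A$, and auxiliary matrix variables playing such a role) are implicitly restricted to the positive definite cone, and this restriction is not counted among the LMIs. *)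

(* Defs.v *)
From mathcomp Require Export all_boot all_order all_algebra.
From mathcomp Require Export complex.
From mathcomp Require Export reals exp.

Set Implicit Arguments.
Unset Strict Implicit.
Unset Printing Implicit Defensive.

Import Order.TTheory GRing.Theory Num.Theory.
Local Open Scope ring_scope.
Local Open Scope sesquilinear_scope.
Local Open Scope complex_scope.

(* [0 <= z] and [0 < z] in the order of R[i] entail that z is real. *)
Definition psdmx (R : realType) (n : nat) (A : 'M[R[i]]_n) : Prop :=
  A \is hermsymmx /\ forall v : 'cV[R[i]]_n, 0 <= (v ^t* *m A *m v) 0 0.

Definition pdmx (R : realType) (n : nat) (A : 'M[R[i]]_n) : Prop :=
  A \is hermsymmx /\
  forall v : 'cV[R[i]]_n, v != 0 -> 0 < (v ^t* *m A *m v) 0 0.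

(* Functional calculus applied to x |-> x ^ s, from the unitary
   diagonalization A = P^-1 *m diag_mx d *m P.  It is only meant for positive
   definite A, or for positive semidefinite A and s > 0 (0 `^ s = 0 for
   s != 0); the eigenvalues are then nonnegative reals, so that taking real
   parts loses nothing. *)
Definition mxpowR (R : realType) (n : nat) (A : 'M[R[i]]_n) (s : R) :
    'M[R[i]]_n :=
  invmx (spectralmx A)
  *m diag_mx (\row_j ((complex.Re (spectral_diag A 0 j)) `^ s)%:C)
  *m spectralmx A.

(* The trace is that of a positive semidefinite matrix, hence real. *)
Definition Upsilon (R : realType) (n m : nat) (K : 'M[R[i]]_(n, m)) (t : R)
    (A : 'M[R[i]]_n) : R :=
  complex.Re (\tr (mxpowR (K ^t* *m mxpowR A t *m K) t^-1)).

Definition hypograph (R : realType) (n : nat) (f : 'M[R[i]]_n -> R)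
    (x : 'M[R[i]]_n * R) : Prop :=
  pdmx x.1 /\ x.2 <= f x.1.

Definition epigraph (R : realType) (n : nat) (f : 'M[R[i]]_n -> R)
    (x : 'M[R[i]]_n * R) : Prop :=
  pdmx x.1 /\ f x.1 <= x.2.

(* A linear matrix inequality of size N in real variables indexed by I. *)
Record lmi (R : realType) (I : finType) (N : nat) := Lmi {
  lmi_const : 'M[R[i]]_N;
  lmi_coef : I -> 'M[R[i]]_N;
  lmi_const_herm : lmi_const \is hermsymmx;
  lmi_coef_herm : forall k, lmi_coef k \is hermsymmx }.

Definition lmi_holds (R : realType) (I : finType) (N : nat) (F : lmi R I N)
    (x : I -> R) : Prop :=
  psdmx (lmi_const F + \sum_k (x k)%:C *: lmi_coef F k).

(* The n ^ 2 + 1 real coordinates of a point (A, tau) of H^n x R: [None]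
   stands for tau, [Some (i, j)] for Re A_ij if i <= j and for Im A_ij if
   j < i. *)
Definition herm_coord (R : realType) (n : nat) (x : 'M[R[i]]_n * R)
    (k : option ('I_n * 'I_n)) : R :=
  match k with
  | None => x.2
  | Some (i, j) =>
      if (i <= j)%N then complex.Re (x.1 i j) else complex.Im (x.1 i j)
  end.

Definition join_vars (R : realType) (I J : finType) (x : I -> R) (y : J -> R)
    (k : I + J) : R :=
  match k with inl i => x i | inr j => y j end.

(* [sdp_representation S ns]: the subset S of H^n_{++} x R is described by
   size ns LMIs, the i-th one of size ns`_i, in the coordinates of (A, tau)
   and finitely many auxiliary real variables y.  Only the constraint that A
   is positive definite comes for free: the auxiliary variables are subject
   to no constraint other than the listed LMIs. *)
Definition sdp_representation (R : realType) (n : nat)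
    (S : 'M[R[i]]_n * R -> Prop) (ns : seq nat) : Prop :=
  exists (k : nat)
         (L : forall i : 'I_(size ns),
              lmi R (option ('I_n * 'I_n) + 'I_k)%type (nth 0%N ns i)),
  forall x : 'M[R[i]]_n * R,
    S x <-> (pdmx x.1 /\
      exists y : 'I_k -> R,
        forall i, lmi_holds (L i) (join_vars (herm_coord x) y)).

(* Main.v *)
(* By Young's trace inequality, t Upsilon_t(A) is the maximum over B >= 0 (for
   0 < t <= 1), respectively the minimum (for t < 0 or t >= 1), of
     tr (K^* A^t K B^(1-t)) - (1 - t) tr B,
   and that trace is the value at vec K of the quadratic form of a weighted
   geometric mean of the commuting matrices A (x) I and I (x) B (B being
   replaced by its transpose).  For 0 < t <= 1 the mean has weight t = p/q; in
   the other cases the form is X M^-1 X with X one of the two matrices and M a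
   mean of weight in [0, 1] and denominator q, which costs one more LMI.

   Means of dyadic weight are towers of midpoints [[X, Z], [Z, Y]] >= 0.  With
   2^l <= q < 2^(l+1) and p <= 2^l, the mean T of weight p/q solves
   X #_(q/2^l) T = X #_(p/2^l) Y, which takes two towers of height l and one
   block.  Since A (x) I and I (x) B are simultaneously diagonal, the auxiliary
   matrices only have to be bounded above by diagonal ones.  For the implicit
   equation, let lam be the largest generalized eigenvalue of T relatively to
   the expected diagonal bound G and w = q/2^l - 1: starting from T <= lam G the
   constraints give T <= lam^((1-w)/2) G, so lam <= lam^((1-w)/2), and lam <= 1.

   The block for X M^-1 X is replaced by [[c, (X vec K)^*], [X vec K, M]] >= 0,
   so that the minimum is attained even when K is not injective (B is then
   singular), and the mn x mn LMI states I (x) B >= 0. *)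
Require Import Defs.
From mathcomp Require Import sequences mxtens ring lra.
Set Implicit Arguments.
Unset Strict Implicit.
Unset Printing Implicit Defensive.
Import Order.TTheory GRing.Theory Num.Theory.
Local Open Scope ring_scope.
Local Open Scope sesquilinear_scope.
Local Open Scope complex_scope.

(** * Sesquilinear forms, the spectral theorem and generalized eigenvalues *)

Section SesquilinearForms.
Variable R : realType.
Local Notation C := R[i].

Definition sesq n m (A : 'M[C]_(n, m)) (u : 'cV[C]_n) (v : 'cV[C]_m) : C :=
  (u ^t* *m A *m v) 0 0.

Definition qf n (A : 'M[C]_n) (v : 'cV[C]_n) : C := sesq A v v.

Lemma conj_rc (r : R) : Num.conj (r%:C) = r%:C :> C.
Proof. exact: conjc_real. Qed.

Lemma hermP n (A : 'M[C]_n) : (A \is hermsymmx) <-> A ^t* = A.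
Proof.
split=> [/is_hermitianmxP|AE]; first by rewrite expr0 scale1r => /esym.
by apply/is_hermitianmxP; rewrite expr0 scale1r.
Qed.

Lemma adjM n m p (A : 'M[C]_(n, m)) (B : 'M[C]_(m, p)) :
  (A *m B) ^t* = B ^t* *m A ^t*.
Proof. by rewrite trmx_mul map_mxM. Qed.

Lemma adjD n m (A B : 'M[C]_(n, m)) : (A + B) ^t* = A ^t* + B ^t*.
Proof. by rewrite linearD map_mxD. Qed.

Lemma adjE n m (A : 'M[C]_(n, m)) i j : (A ^t*) i j = Num.conj (A j i).
Proof. by rewrite !mxE. Qed.

Lemma hermE n (A : 'M[C]_n) i j : A \is hermsymmx -> Num.conj (A i j) = A j i.
Proof. by move=> /hermP AE; rewrite -[in RHS]AE adjE. Qed.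

Lemma sesqNl n m (A : 'M[C]_(n, m)) u v : sesq A (- u) v = - sesq A u v.
Proof. by rewrite /sesq linearN map_mxN !mulNmx mxE. Qed.

Lemma sesqNr n m (A : 'M[C]_(n, m)) u v : sesq A u (- v) = - sesq A u v.
Proof. by rewrite /sesq mulmxN mxE. Qed.

Lemma sesqZm n m (A : 'M[C]_(n, m)) (r : C) u v :
  sesq (r *: A) u v = r * sesq A u v.
Proof. by rewrite /sesq -scalemxAr -scalemxAl mxE. Qed.

Lemma sesq0m n m u v : sesq (0 : 'M[C]_(n, m)) u v = 0.
Proof. by rewrite /sesq mulmx0 mul0mx mxE. Qed.

Lemma sesqM n m p (A : 'M[C]_(n, m)) (B : 'M[C]_(m, p)) u v :
  sesq (A *m B) u v = sesq A u (B *m v).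
Proof. by rewrite /sesq !mulmxA. Qed.

Lemma sesqMadj n m p (A : 'M[C]_(m, p)) (B : 'M[C]_(m, n)) u v :
  sesq (B ^t* *m A) u v = sesq A (B *m u) v.
Proof. by rewrite /sesq adjM !mulmxA. Qed.

Lemma sesq_conj n (A : 'M[C]_n) u v :
  A \is hermsymmx -> Num.conj (sesq A u v) = sesq A v u.
Proof.
move=> /hermP AE; rewrite /sesq -[LHS]adjE !adjM AE trmxCK mulmxA //.
Qed.

Lemma sesq_sum n m (A : 'M[C]_(n, m)) u v :
  sesq A u v = \sum_i \sum_j Num.conj (u i 0) * A i j * v j 0.
Proof.
rewrite exchange_big /sesq mxE; apply: eq_bigr => j _.
by rewrite mxE big_distrl; apply: eq_bigr => i _; rewrite adjE.
Qed.

Lemma psdmxP n (A : 'M[C]_n) :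
  psdmx A <-> A \is hermsymmx /\ forall v, 0 <= qf A v.
Proof. by []. Qed.

Definition loewner n (A B : 'M[C]_n) := forall v, qf A v <= qf B v.

Lemma sesq_block n m (A : 'M[C]_n) (B : 'M[C]_(n, m)) B' (D : 'M[C]_m)
    (u u' : 'cV[C]_n) (v v' : 'cV[C]_m) :
  sesq (block_mx A B B' D) (col_mx u v) (col_mx u' v') =
  sesq A u u' + sesq B u v' + (sesq B' v u' + sesq D v v').
Proof.
rewrite /sesq tr_col_mx map_row_mx mul_row_block mul_row_col !mulmxDl !mxE /=.
by rewrite !addrA; congr (_ + _); rewrite addrAC.
Qed.

Lemma herm_block n m (A : 'M[C]_n) (B : 'M[C]_(n, m)) (D : 'M[C]_m) :
  A \is hermsymmx -> D \is hermsymmx -> block_mx A B (B ^t*) D \is hermsymmx.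
Proof.
move=> /hermP AE /hermP DE; apply/hermP.
by rewrite tr_block_mx map_block_mx AE DE trmxCK.
Qed.

Lemma herm_cong n m (V : 'M[C]_(m, n)) (A : 'M[C]_m) :
  A \is hermsymmx -> V ^t* *m A *m V \is hermsymmx.
Proof. by move=> /hermP AE; apply/hermP; rewrite !adjM trmxCK AE mulmxA. Qed.

Lemma qf_cong n m (V : 'M[C]_(m, n)) (A : 'M[C]_m) v :
  qf (V ^t* *m A *m V) v = qf A (V *m v).
Proof. by rewrite /qf sesqM sesqMadj. Qed.

Lemma psd_cong n m (V : 'M[C]_(m, n)) (A : 'M[C]_m) :
  psdmx A -> psdmx (V ^t* *m A *m V).
Proof.
move=> /psdmxP[Ah Ap]; apply/psdmxP; split; first exact: herm_cong.
by move=> v; rewrite qf_cong.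
Qed.

Definition dgC n (d : 'rV[R]_n) : 'M[C]_n :=
  diag_mx (map_mx (real_complex R) d).

Lemma dgC_herm n (d : 'rV[R]_n) : dgC d \is hermsymmx.
Proof.
apply/hermP; rewrite tr_diag_mx map_diag_mx; congr diag_mx.
by apply/rowP => i; rewrite !mxE; exact: conjc_real.
Qed.

Lemma sesq_dgC n (d : 'rV[R]_n) u v :
  sesq (dgC d) u v = \sum_i (d 0 i)%:C * (Num.conj (u i 0) * v i 0).
Proof.
rewrite sesq_sum; apply: eq_bigr => i _; rewrite (bigD1 i) //= big1 ?addr0.
  by rewrite !mxE eqxx mulr1n mulrCA mulrA.
by move=> j ji; rewrite !mxE eq_sym (negbTE ji) mulr0n mulr0 mul0r.
Qed.

Lemma dgC_mul n (d : 'rV[R]_n) (v : 'cV[C]_n) i :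
  (dgC d *m v) i 0 = (d 0 i)%:C * v i 0.
Proof. by rewrite mul_diag_mx !mxE. Qed.

Lemma normCK' (z : C) : Num.conj z * z = `|z| ^+ 2.
Proof. by rewrite normCK mulrC. Qed.

Lemma qf_dgC n (d : 'rV[R]_n) v :
  qf (dgC d) v = \sum_i (d 0 i)%:C * `|v i 0| ^+ 2.
Proof. by rewrite /qf sesq_dgC; apply: eq_bigr => i _; rewrite normCK'. Qed.

Lemma ltr0c (x : R) : ((0 : C) < x%:C) = (0 < x).
Proof. by rewrite -ltcR. Qed.

Lemma dgCZ n (r : R) (d : 'rV[R]_n) : dgC (r *: d) = r%:C *: dgC d.
Proof. by apply/matrixP => i j; rewrite !mxE rmorphM mulrnAr. Qed.

Lemma scaled_normc2_ge0 (r : R) (z : C) : 0 <= r -> 0 <= r%:C * `|z| ^+ 2.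
Proof. by move=> r0; rewrite mulr_ge0 ?exprn_ge0 ?normr_ge0 // ler0c. Qed.

Lemma dgC_le n (d e : 'rV[R]_n) :
  (forall i, d 0 i <= e 0 i) -> loewner (dgC d) (dgC e).
Proof.
move=> de v; rewrite !qf_dgC; apply: ler_sum => i _.
by rewrite ler_wpM2r ?exprn_ge0 // lecR.
Qed.

Lemma qf_dgC_gt0 n (d : 'rV[R]_n) v :
  (forall i, 0 < d 0 i) -> v != 0 -> 0 < qf (dgC d) v.
Proof.
move=> d0 /cV0Pn[i vi]; rewrite qf_dgC (bigD1 i) //= ltr_wpDr //.
  by apply: sumr_ge0 => j _; rewrite scaled_normc2_ge0 // ltW.
by rewrite mulr_gt0 ?exprn_gt0 ?normr_gt0 // ltr0c.
Qed.

Lemma herm_real (z : C) : Num.conj z = z -> (complex.Re z)%:C = z.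
Proof. by move=> zz; apply: RRe_real; apply/CrealP. Qed.

Definition nsq (z : C) : R := complex.Re z ^+ 2 + complex.Im z ^+ 2.

Lemma nsqE (z : C) : `|z| ^+ 2 = (nsq z)%:C.
Proof. by rewrite add_Re2_Im2. Qed.

Lemma nsq_ge0 z : 0 <= nsq z.
Proof. by rewrite addr_ge0 ?sqr_ge0. Qed.

Lemma nsqZ (r : R) z : nsq (r%:C * z) = r ^+ 2 * nsq z.
Proof. by case: z => a b; rewrite /nsq /=; ring. Qed.

Lemma nsq_eq0 z : nsq z = 0 -> z = 0.
Proof.
move=> z0; apply/eqP; rewrite -normr_eq0 -sqrf_eq0 nsqE z0; exact/eqP.
Qed.

Lemma qf_dgC_nsq n (d : 'rV[R]_n) v :
  qf (dgC d) v = (\sum_i d 0 i * nsq (v i 0))%:C.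
Proof.
by rewrite qf_dgC rmorph_sum; apply: eq_bigr => i _; rewrite nsqE rmorphM.
Qed.

Lemma unitary_adjK n (U : 'M[C]_n) : U \is unitarymx ->
  U *m U ^t* = 1%:M /\ U ^t* *m U = 1%:M.
Proof. by move=> /unitarymxP UU; split=> //; apply: mulmx1C. Qed.

Lemma unitary_row_nsq n (M : 'M[C]_n) i : M \is unitarymx ->
  \sum_j nsq (M i j) = 1.
Proof.
move=> /unitary_adjK[/matrixP/(_ i i) MM _]; apply: complexI.
rewrite rmorph_sum rmorph1; move: MM; rewrite !mxE eqxx mulr1n => <-.
by apply: eq_bigr => j _; rewrite adjE -normCK nsqE.
Qed.

Lemma unitary_col_nsq n (M : 'M[C]_n) j : M \is unitarymx ->
  \sum_i nsq (M i j) = 1.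
Proof.
move=> /unitary_adjK[_ /matrixP/(_ j j) MM]; apply: complexI.
rewrite rmorph_sum rmorph1; move: MM; rewrite !mxE eqxx mulr1n => <-.
by apply: eq_bigr => i _; rewrite adjE normCK' nsqE.
Qed.

Definition real_spectrum n (A : 'M[C]_n) : 'rV[R]_n :=
  \row_j complex.Re (spectral_diag A 0 j).

Lemma spectral_decomposition n (A : 'M[C]_n) : A \is hermsymmx ->
  A = (spectralmx A) ^t* *m dgC (real_spectrum A) *m spectralmx A.
Proof.
move=> Ah; have /hermitian_normalmx/orthomx_spectralP {1}-> := Ah.
rewrite (invmx_unitary (spectral_unitarymx A)).
suff -> : diag_mx (spectral_diag A) = dgC (real_spectrum A) by [].
congr diag_mx; apply/rowP => i; rewrite !mxE; apply/esym/RRe_real.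
by have /mxOverP := hermitian_spectral_diag_real Ah; apply.
Qed.

Lemma mxpowRE n (A : 'M[C]_n) (s : R) :
  mxpowR A s = (spectralmx A) ^t* *m
    dgC (\row_j (real_spectrum A 0 j) `^ s) *m spectralmx A.
Proof.
rewrite /mxpowR (invmx_unitary (spectral_unitarymx A)).
set d := diag_mx _; suff -> : d = dgC (\row_j (real_spectrum A 0 j) `^ s) by [].
by congr diag_mx; apply/rowP => i; rewrite !mxE.
Qed.

Lemma tr_cong_dgC n (U : 'M[C]_n) (d : 'rV[R]_n) : U \is unitarymx ->
  \tr (U ^t* *m dgC d *m U) = (\sum_j d 0 j)%:C.
Proof.
move=> /unitary_adjK[UU _].
rewrite mxtrace_mulC mulmxA UU mul1mx mxtrace_diag rmorph_sum.
by apply: eq_bigr => j _; rewrite mxE.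
Qed.

Lemma tr_mxpowR n (A : 'M[C]_n) (s : R) :
  complex.Re (\tr (mxpowR A s)) = \sum_j (real_spectrum A 0 j) `^ s.
Proof.
rewrite mxpowRE tr_cong_dgC ?spectral_unitarymx //=.
by apply: eq_bigr => j _; rewrite mxE.
Qed.

(** The vector is a unit eigenvector, a column of the adjoint of [spectralmx A]; in this way sign
    conditions on the form pass to the spectrum. *)
Lemma real_spectrum_qf n (A : 'M[C]_n) j : A \is hermsymmx ->
  (real_spectrum A 0 j)%:C = qf A ((spectralmx A) ^t* *m delta_mx j 0).
Proof.
move=> Ah; rewrite {2}(spectral_decomposition Ah) qf_cong mulmxA.
have [-> _] := unitary_adjK (spectral_unitarymx A).
rewrite mul1mx qf_dgC_nsq; congr (_%:C); rewrite (bigD1 j) //= big1.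
  by rewrite !mxE !eqxx /nsq /= expr1n expr0n /= !addr0 mulr1.
by move=> i ij; rewrite !mxE (negbTE ij) /nsq /= expr0n addr0 mulr0.
Qed.

Lemma real_spectrum_ge0 n (A : 'M[C]_n) j : psdmx A -> 0 <= real_spectrum A 0 j.
Proof.
by move=> /psdmxP[Ah Ap]; rewrite -ler0c real_spectrum_qf.
Qed.

Lemma real_spectrum_gt0 n (A : 'M[C]_n) j : pdmx A -> 0 < real_spectrum A 0 j.
Proof.
move=> [Ah Ap]; rewrite -ltr0c real_spectrum_qf //; apply: Ap.
apply/eqP => /(congr1 (mulmx (spectralmx A))); rewrite mulmxA.
have [-> _] := unitary_adjK (spectral_unitarymx A).
by rewrite mul1mx mulmx0 => /matrixP/(_ j 0)/eqP; rewrite !mxE !eqxx oner_eq0.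
Qed.

(** A zero eigenvalue would put a nonzero column of the adjoint of [spectralmx A] into the kernel of
    [A]. *)
Lemma real_spectrum_unit_gt0 n (A : 'M[C]_n) j : psdmx A -> A \in unitmx ->
  0 < real_spectrum A 0 j.
Proof.
move=> Ap Au; rewrite lt0r real_spectrum_ge0 // andbT; apply/eqP => a0.
have Ah := Ap.1.
pose u : 'cV[C]_n := (spectralmx A) ^t* *m delta_mx j 0.
have Au0 : A *m u = 0.
  rewrite (spectral_decomposition Ah) /u -!mulmxA [X in dgC _ *m X]mulmxA.
  have [-> _] := unitary_adjK (spectral_unitarymx A).
  rewrite mul1mx.
  suff -> : dgC (real_spectrum A) *m delta_mx j 0 = 0 :> 'cV[C]_n.
    by rewrite mulmx0.
  apply/colP => i; rewrite dgC_mul [delta_mx _ _ _ _]mxE [RHS]mxE.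
  by case: eqP => [->|_]; rewrite ?mulr0 // a0 mul0r.
have u0 : u = 0 by rewrite -[u](mulKmx Au) Au0 mulmx0.
have := congr1 (mulmx (spectralmx A)) u0; rewrite /u mulmxA.
have [-> _] := unitary_adjK (spectral_unitarymx A).
by rewrite mul1mx mulmx0 => /matrixP/(_ j 0)/eqP; rewrite !mxE !eqxx oner_eq0.
Qed.

Lemma psd_dgC n (d : 'rV[R]_n) : (forall i, 0 <= d 0 i) -> psdmx (dgC d).
Proof.
move=> d0; apply/psdmxP; split=> [|v]; first exact: dgC_herm.
by rewrite qf_dgC_nsq ler0c sumr_ge0 // => i _; rewrite mulr_ge0 ?nsq_ge0.
Qed.

(** With [D = G^(-1/2)] and [E = G^(1/2)] the pencil becomes the Hermitian matrix [H = D Z D]: [lam]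
    is the largest eigenvalue of [H], and [u] is the image under [D] of an eigenvector for it. *)
Lemma generalized_eigenvalue n (Z : 'M[C]_n) (g : 'rV[R]_n) :
    (0 < n)%N -> Z \is hermsymmx -> (forall i, 0 < g 0 i) ->
  exists lam : R, loewner Z (lam%:C *: dgC g) /\
    exists2 u : 'cV[C]_n, u != 0 & Z *m u = lam%:C *: (dgC g *m u).
Proof.
move=> n0 Zh g0.
pose D := dgC (\row_i (Num.sqrt (g 0 i))^-1).
pose E := dgC (\row_i Num.sqrt (g 0 i)).
have DE : D *m E = 1%:M.
  apply/matrixP => i j; rewrite mul_diag_mx !mxE mulrnAr; case: eqP => //= _.
  by rewrite -rmorphM /= mulVf // gt_eqF // sqrtr_gt0.
have ED : E *m D = 1%:M by apply: mulmx1C.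
have EE : E *m E = dgC g.
  apply/matrixP => i j; rewrite mul_diag_mx !mxE mulrnAr; case: eqP => //= _.
  by rewrite -rmorphM /= -expr2 sqr_sqrtr // ltW.
have Dh : D ^t* = D by apply/hermP/dgC_herm.
have Eh : E ^t* = E by apply/hermP/dgC_herm.
pose H := D *m Z *m D.
have Hh : H \is hermsymmx by rewrite /H -{1}Dh; exact: herm_cong.
pose U := spectralmx H; pose r := real_spectrum H.
have [UU' UU] := unitary_adjK (spectral_unitarymx H).
have HE : H = U ^t* *m dgC r *m U by exact: spectral_decomposition.
pose i1 : 'I_n := Ordinal n0.
have [i0 imax] : exists i0, forall i, r 0 i <= r 0 i0.
  by case: (@arg_maxP _ R _ i1 xpredT (fun i => r 0 i)) => // i _ h1;
    exists i => j; exact: h1.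
exists (r 0 i0).
(* The change of variables [U E] diagonalizes [Z] and turns [G] into the identity at once. *)
have ZE : Z = (U *m E) ^t* *m dgC r *m (U *m E).
  rewrite adjM Eh !mulmxA -(mulmxA E) -(mulmxA E) -HE /H.
  by rewrite !mulmxA ED mul1mx -mulmxA DE mulmx1.
have GE : dgC g = (U *m E) ^t* *m (U *m E).
  by rewrite adjM Eh mulmxA -(mulmxA E) UU mulmx1 EE.
split.
  move=> v; rewrite ZE qf_cong /qf sesqZm GE -[X in X *m (U *m E)]mulmx1.
  rewrite -/(qf _ v) qf_cong.
  have -> : 1%:M = dgC (const_mx 1 : 'rV[R]_n).
    by apply/matrixP => i j; rewrite !mxE.
  rewrite -/(qf (dgC r) _) !qf_dgC mulr_sumr; apply: ler_sum => i _.
  by rewrite [const_mx _ _ _]mxE rmorph1 mul1r ler_wpM2r ?exprn_ge0 // lecR.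
exists (D *m U ^t* *m delta_mx i0 0).
  apply/eqP => /(congr1 (mulmx (U *m E))).
  rewrite mulmx0 !mulmxA -(mulmxA U) ED mulmx1 UU' mul1mx => /matrixP/(_ i0 0).
  by rewrite !mxE !eqxx => /eqP; rewrite oner_eq0.
rewrite ZE GE -!mulmxA scalemxAr; congr (_ *m _).
rewrite !(mulmxA E) ED mul1mx !(mulmxA U) UU' mul1mx.
apply/colP => i; rewrite dgC_mul !mxE.
by case: eqP => [->|_]; rewrite ?mulr1 ?mulr0.
Qed.

Lemma loewner_scale_le1 n (Z : 'M[C]_n) (g : 'rV[R]_n) (lam : R) :
    lam <= 1 -> (forall i, 0 <= g 0 i) ->
  loewner Z (lam%:C *: dgC g) -> loewner Z (dgC g).
Proof.
move=> lam1 g0 Zl v; apply: le_trans (Zl v) _; rewrite /qf sesqZm -/(qf _ v).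
have q0 : 0 <= qf (dgC g) v.
  by rewrite qf_dgC; apply: sumr_ge0 => i _; rewrite scaled_normc2_ge0.
by rewrite ler_piMl // -[1]/(1%:C) lecR.
Qed.

(* Noncommutative AM-GM for commuting diagonal blocks: at a generalized
   eigenvector [Z u = lam G u], positivity of the block matrix on the vector
   [(G D1^-1 u, - u)] reads [2 lam <= 2]. *)
Lemma block_le_geomean n (Z D1 D2 : 'M[C]_n) (d1 d2 g : 'rV[R]_n) :
    (0 < n)%N -> Z \is hermsymmx -> psdmx (block_mx D1 Z Z D2) ->
    loewner D1 (dgC d1) -> loewner D2 (dgC d2) ->
    (forall i, 0 < d1 0 i) -> (forall i, 0 < g 0 i) ->
    (forall i, g 0 i ^+ 2 = d1 0 i * d2 0 i) ->
  loewner Z (dgC g).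
Proof.
move=> n0 Zh /psdmxP[_ Bp] D1d D2d d10 g0 gd.
have [lam [Zl [u u0 Zu]]] := generalized_eigenvalue n0 Zh g0.
have d20 i : 0 < d2 0 i.
  by rewrite -(pmulr_rgt0 _ (d10 i)) -gd exprn_gt0.
apply: (loewner_scale_le1 _ _ Zl) => [|i]; last exact: ltW.
pose x := dgC (\row_i (g 0 i / d1 0 i)) *m u.
have := Bp (col_mx x (- u)); rewrite /qf sesq_block !sesqNr !sesqNl opprK.
(* Because [g^2 = d1 d2], the forms of [dgC d1] at [x], of [dgC g] between [x] and [u], and of
   [dgC d2] at [u] share one value. *)
have x1 : sesq (dgC d1) x x = qf (dgC d2) u.
  rewrite qf_dgC -[LHS]/(qf _ _) qf_dgC; apply: eq_bigr => i _.
  rewrite dgC_mul normrM exprMn mulrA; congr (_ * _).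
  rewrite mxE normc_def /= expr0n /= addr0 sqrtr_sqr -!rmorphXn -rmorphM /=.
  congr (_%:C); rewrite real_normK ?num_real // exprMn gd.
  by rewrite expr2; field; rewrite gt_eqF.
have x2 : sesq (dgC g) x u = qf (dgC d2) u.
  rewrite qf_dgC sesq_dgC; apply: eq_bigr => i _.
  rewrite dgC_mul rmorphM /= mxE -mulrA normCK' mulrA; congr (_ * _).
  rewrite conj_rc -rmorphM /=; congr (_%:C).
  rewrite mulrA -expr2 gd; field; by rewrite gt_eqF.
have x2' : sesq (dgC g) u x = qf (dgC d2) u.
  by rewrite -sesq_conj ?dgC_herm // x2 /qf sesq_conj ?dgC_herm.
have -> : sesq Z x u = lam%:C * qf (dgC d2) u.
  by rewrite -x2 /sesq -!mulmxA Zu -!scalemxAr mxE.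
have -> : sesq Z u x = lam%:C * qf (dgC d2) u.
  rewrite -sesq_conj // -[sesq Z x u]/((x ^t* *m Z *m u) 0 0) -mulmxA Zu.
  rewrite -scalemxAr mulmxA mxE rmorphM /=.
  rewrite -[X in _ * Num.conj X]/(sesq (dgC g) x u).
  by rewrite sesq_conj ?dgC_herm // x2' ; congr (_ * _); exact: conj_rc.
move=> h; have : 0 <= qf (dgC d2) u - lam%:C * qf (dgC d2) u
    + (- (lam%:C * qf (dgC d2) u) + qf (dgC d2) u).
  have h1 : sesq D1 x x <= qf (dgC d2) u by rewrite -x1; exact: D1d.
  apply: le_trans h _; apply: lerD; first exact: lerD.
  by apply: lerD; last exact: D2d.
have q0 := qf_dgC_gt0 d20 u0.
have -> : forall q : C, q - lam%:C * q + (- (lam%:C * q) + q) =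
     ((1 - lam) *+ 2)%:C * q.
  by move=> q; rewrite rmorphMn rmorphB rmorph1; ring.
by rewrite pmulr_lge0 // ler0c pmulrn_lge0 // subr_ge0.
Qed.

End SesquilinearForms.

(** * Real powers and scalar weighted geometric means *)

Section PowerLemmas.
Variable R : realType.
Implicit Types (x y a b w : R).

(** A power of 0 is 1 for exponent 0 and 0 otherwise, so at [x = 0] the law fails only when nonzero
    exponents cancel; nonnegative ones cannot. *)
Lemma powRD_nneg x a b : 0 <= a -> 0 <= b -> x `^ (a + b) = x `^ a * x `^ b.
Proof.
move=> a0 b0; have [->|x0] := eqVneq x 0; last by rewrite powRD // x0 implybT.
have [ab0|ab0] := eqVneq (a + b) 0; last by rewrite powRD // (negbTE ab0).
move/eqP: ab0; rewrite paddr_eq0 // => /andP[/eqP-> /eqP->].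
by rewrite addr0 !powRr0 mulr1.
Qed.

Lemma sqrt_powR x a : Num.sqrt (x `^ a) = x `^ (a / 2).
Proof. by rewrite -powR12_sqrt ?powR_ge0 // powRrM. Qed.

(** The scalar weighted geometric mean [x #_w y]. *)
Definition wgeo x y w := x `^ (1 - w) * y `^ w.

Lemma wgeo_ge0 x y w : 0 <= wgeo x y w.
Proof. by rewrite mulr_ge0 ?powR_ge0. Qed.

Lemma wgeo_gt0 x y w : 0 < x -> 0 < y -> 0 < wgeo x y w.
Proof. by move=> x0 y0; rewrite mulr_gt0 ?powR_gt0. Qed.

Lemma wgeoC x y w : wgeo x y (1 - w) = wgeo y x w.
Proof. by rewrite /wgeo subKr mulrC. Qed.

Lemma wgeo_bool x y (c : bool) : 0 <= x -> 0 <= y ->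
  wgeo x y c%:R = if c then y else x.
Proof.
move=> x0 y0; rewrite /wgeo; case: c; rewrite /= ?subrr ?subr0 powRr0 powRr1 //.
  by rewrite mul1r.
by rewrite mulr1.
Qed.

(** Scalar form of the implicit equation for [T = x #_th y]: the exponents of [y] agree when
    [2 th = r + th (1 - w)], that is [th (1 + w) = r], and those of [x] follow since both sides have
    degree 2. *)
Lemma wgeo_sqr x y r th w : 0 <= x -> 0 <= y ->
    0 <= r <= 1 -> 0 <= th <= 1 -> 0 <= w <= 1 -> th * (1 + w) = r ->
  wgeo x y th ^+ 2 = wgeo x y r * wgeo (wgeo x y th) x w.
Proof.
move=> x0 y0 /andP[r0 r1] /andP[t0 t1] /andP[w0 w1] thw.
have rX : 0 <= 1 - r by rewrite subr_ge0.
have tX : 0 <= 1 - th by rewrite subr_ge0.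
have wX : 0 <= 1 - w by rewrite subr_ge0.
have twX : 0 <= (1 - th) * (1 - w) by exact: mulr_ge0.
have twY : 0 <= th * (1 - w) by exact: mulr_ge0.
rewrite /wgeo [in RHS]powRM ?powR_ge0 // -!powRrM exprMn !expr2.
rewrite -!powRD_nneg //.
have -> : x `^ (1 - r) * y `^ r *
    (x `^ ((1 - th) * (1 - w)) * y `^ (th * (1 - w)) * x `^ w) =
    (x `^ (1 - r) * (x `^ ((1 - th) * (1 - w)) * x `^ w)) *
    (y `^ r * y `^ (th * (1 - w))) by ring.
have wtX : 0 <= (1 - th) * (1 - w) + w by exact: addr_ge0.
rewrite -!powRD_nneg //.
by congr (_ `^ _ * _ `^ _); rewrite -thw; ring.
Qed.

End PowerLemmas.

(** * Systems of midpoint constraints for means of rational weight *)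

Section DyadicTower.
Variable R : realType.
Local Notation C := R[i].

(* A triple (a, b, c) of nodes stands for the constraint
   [[Z_a, Z_b], [Z_b, Z_c]] >= 0 on matrices attached to the nodes. *)
Definition constraint := (nat * nat * nat)%type.

Definition sys_holds N (Z : nat -> 'M[C]_N) (s : seq constraint) :=
  forall t, t \in s ->
    psdmx (block_mx (Z t.1.1) (Z t.1.2) (Z t.1.2) (Z t.2)).

Definition scalar_holds (e : nat -> R) (s : seq constraint) :=
  forall t, t \in s -> e t.1.2 ^+ 2 <= e t.1.1 * e t.2.

Lemma sys_holds_cat N (Z : nat -> 'M[C]_N) s s' :
  sys_holds Z (s ++ s') -> sys_holds Z s /\ sys_holds Z s'.
Proof. by move=> h; split=> t ts; apply: h; rewrite mem_cat ts ?orbT. Qed.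

Lemma scalar_holds_cat e s s' :
  scalar_holds e s -> scalar_holds e s' -> scalar_holds e (s ++ s').
Proof. by move=> h h' t; rewrite mem_cat => /orP[/h|/h']. Qed.

(* Repeated midpoints: starting from node z, average alternatively with x
   or with y, the k-th average being stored in the fresh node f + k. *)
Fixpoint tower (x y z : nat) (cs : seq bool) (f : nat) : seq constraint :=
  if cs is c :: cs' then
    ((if c then y else x), f, z) :: tower x y f cs' f.+1
  else [::].

Fixpoint tower_out (z : nat) (cs : seq bool) (f : nat) : nat :=
  if cs is _ :: cs' then tower_out f cs' f.+1 else z.

Fixpoint tower_val (x y z : R) (cs : seq bool) : R :=
  if cs is c :: cs' then tower_val x y (Num.sqrt ((if c then y else x) * z)) cs'
  else z.

Fixpoint weight (w : R) (cs : seq bool) : R :=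
  if cs is c :: cs' then weight ((w + c%:R) / 2) cs' else w.

Lemma size_tower x y z cs f : size (tower x y z cs f) = size cs.
Proof. by elim: cs z f => //= c cs IH z f; rewrite IH. Qed.

(** The geometric midpoint of [x #_w y] and an endpoint is again a mean, of weight halfway between
    [w] and 0 or 1. *)
Lemma tower_valE x y w cs : 0 <= x -> 0 <= y -> 0 <= w <= 1 ->
  tower_val x y (wgeo x y w) cs = wgeo x y (weight w cs).
Proof.
move=> x0 y0; elim: cs w => //= c cs IH w /andP[w0 w1].
suff -> : Num.sqrt ((if c then y else x) * wgeo x y w) =
    wgeo x y ((w + c%:R) / 2).
  by apply: IH; case: c => /=; apply/andP; split; lra.
have -> : (if c then y else x) * wgeo x y w =
    x `^ ((1 - w) + (~~ c)%:R) * y `^ (w + c%:R).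
  rewrite (@powRD_nneg _ x (1 - w)) ?(@powRD_nneg _ y w) ?subr_ge0 ?ler0n //.
  by rewrite /wgeo; case: c => /=; rewrite powRr0 powRr1 //; ring.
rewrite sqrtrM ?powR_ge0 // !sqrt_powR /wgeo; congr (_ `^ _ * _ `^ _).
by case: c => /=; field.
Qed.

Lemma tower_out_lt z cs f : (z < f)%N -> (tower_out z cs f < f + size cs)%N.
Proof.
elim: cs z f => [|c cs IH] z f zf /=; first by rewrite addn0.
by rewrite addnS -addSn; apply: IH.
Qed.

Lemma tower_lt x y z cs f t : (x < f)%N -> (y < f)%N -> (z < f)%N ->
    t \in tower x y z cs f ->
  [/\ t.1.1 < f + size cs, t.1.2 < f + size cs & t.2 < f + size cs]%N.
Proof.
elim: cs z f => //= c cs IH z f xf yf zf.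
have fl : (f < f + (size cs).+1)%N by rewrite addnS ltnS leq_addr.
rewrite inE => /predU1P[->/=|].
  by split=> //; [case: (c)|]; apply: ltn_trans fl.
by rewrite addnS -addSn; apply: IH; rewrite ?ltnS ?leqnn // ltnW.
Qed.

Lemma weight_rcons w cs c : weight w (rcons cs c) = (weight w cs + c%:R) / 2.
Proof. by elim: cs w => //= d cs IH w. Qed.

(** A digit expansion of [j / 2^l] in which the last average gives the leading digit; the starting
    weight [c0] contributes [c0 / 2^l], which makes the weight 1 reachable. *)
Lemma dyadic_weight (j l : nat) : (j <= 2 ^ l)%N ->
  exists c0 cs, size cs = l /\ weight (c0 : bool)%:R cs = j%:R / 2 ^+ l.
Proof.
elim: l j => [|l IH] j jl.
  by exists (j == 1)%N, [::]; case: j jl => [|[|]] //= _; rewrite divr1.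
have [jl'|jl'] := leqP j (2 ^ l).
  have [c0 [cs [sz w]]] := IH _ jl'.
  exists c0, (rcons cs false); rewrite size_rcons sz; split => //.
  rewrite weight_rcons w mulr0n addr0 exprS; field.
  by rewrite expf_neq0 ?pnatr_eq0.
have jl2 : (j - 2 ^ l <= 2 ^ l)%N by rewrite leq_subLR addnn -mul2n -expnS.
have [c0 [cs [sz w]]] := IH _ jl2.
exists c0, (rcons cs true); rewrite size_rcons sz; split => //.
rewrite weight_rcons w mulr1n natrB ?(ltnW jl') // natrX exprS; field.
by rewrite expf_neq0 ?pnatr_eq0.
Qed.

(** By [block_le_geomean], each constraint bounds its middle node by the entrywise geometric mean of
    the bounds at its ends, so diagonal bounds propagate along the tower. *)
Lemma tower_sound N (Z : nat -> 'M[C]_N) x y z cs f (xd yd zd : 'rV[R]_N) :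
    (0 < N)%N -> (forall k, Z k \is hermsymmx) ->
    sys_holds Z (tower x y z cs f) ->
    loewner (Z x) (dgC xd) -> loewner (Z y) (dgC yd) ->
    loewner (Z z) (dgC zd) ->
    (forall i, 0 < xd 0 i) -> (forall i, 0 < yd 0 i) ->
    (forall i, 0 < zd 0 i) ->
  loewner (Z (tower_out z cs f))
    (dgC (\row_i tower_val (xd 0 i) (yd 0 i) (zd 0 i) cs)).
Proof.
move=> N0 Zh; elim: cs z f zd => [|c cs IH] z f zd /= sh xl yl zl x0 y0 z0.
  suff -> : \row_i zd 0 i = zd by [].
  by apply/rowP => i; rewrite mxE.
pose zd' := \row_i Num.sqrt ((if c then yd 0 i else xd 0 i) * zd 0 i).
have z'0 i : 0 < zd' 0 i.
  by rewrite mxE sqrtr_gt0 mulr_gt0 //; case: c {sh zd'}.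
have sh' : sys_holds Z (tower x y f cs f.+1).
  by move=> t ts; apply: sh; rewrite inE ts orbT.
have sh0 := sh (_, _, _) (mem_head _ _).
have cl : loewner (Z (if c then y else x)) (dgC (if c then yd else xd)).
  by case: (c).
have c0 i : 0 < (if c then yd else xd) 0 i by case: (c).
suff fl : loewner (Z f) (dgC zd').
  have := IH f f.+1 zd' sh' xl yl fl x0 y0 z'0; congr (loewner _ (dgC _)).
  by apply/rowP => i; rewrite !mxE.
apply: (block_le_geomean N0 (Zh f) sh0 cl zl c0 z'0) => i.
rewrite mxE sqr_sqrtr; last by rewrite mulr_ge0 // ltW //; case: (c).
by case: (c).
Qed.

(** Filling every fresh node with the exact geometric mean turns the constraints into equalities;
    fresh nodes start at [f], so earlier values survive. *)
Lemma tower_complete (e : nat -> R) x y z cs f :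
    (forall k, 0 <= e k) -> (x < f)%N -> (y < f)%N -> (z < f)%N ->
  exists e', [/\ forall k, 0 <= e' k, forall k, (k < f)%N -> e' k = e k,
    scalar_holds e' (tower x y z cs f) &
    e' (tower_out z cs f) = tower_val (e x) (e y) (e z) cs].
Proof.
elim: cs e z f => [|c cs IH] e z f e0 xf yf zf /=; first by exists e; split.
pose v := Num.sqrt ((if c then e y else e x) * e z).
pose e1 k := if k == f then v else e k.
have e1E k : (k < f)%N -> e1 k = e k by rewrite /e1 => /ltn_eqF ->.
have e10 k : 0 <= e1 k by rewrite /e1; case: eqP => // _; exact: sqrtr_ge0.
have [e' [e'0 e'E e's e'o]] :=
  IH e1 f f.+1 e10 (ltnW xf) (ltnW yf) (leqnn _).
exists e'; split => //.
- by move=> k kf; rewrite e'E ?e1E // ltnW.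
- move=> t; rewrite inE => /predU1P[->/=|]; last exact: e's.
  rewrite !e'E ?ltnS ?leqnn ?(ltnW zf) //; last by case: (c); rewrite ltnW.
  rewrite {1}/e1 eqxx sqr_sqrtr ?mulr_ge0 //; last by case: (c).
  by rewrite !e1E //; case: (c).
- by rewrite e'o (e1E x) ?(e1E y) // /e1 eqxx.
Qed.

Lemma tower_bound N (Z : nat -> 'M[C]_N) x y (c : bool) cs f
    (xd yd : 'rV[R]_N) :
    (0 < N)%N -> (forall k, Z k \is hermsymmx) ->
    sys_holds Z (tower x y (if c then y else x) cs f) ->
    loewner (Z x) (dgC xd) -> loewner (Z y) (dgC yd) ->
    (forall i, 0 < xd 0 i) -> (forall i, 0 < yd 0 i) ->
  loewner (Z (tower_out (if c then y else x) cs f))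
    (dgC (\row_i wgeo (xd 0 i) (yd 0 i) (weight c%:R cs))).
Proof.
move=> N0 Zh sh xl yl x0 y0.
have zl : loewner (Z (if c then y else x)) (dgC (if c then yd else xd)).
  by case: (c).
have z0 i : 0 < (if c then yd else xd) 0 i by case: (c).
have := tower_sound N0 Zh sh xl yl zl x0 y0 z0; congr (loewner _ (dgC _)).
have c01 : 0 <= (c%:R : R) <= 1 by case: (c); rewrite /= ?lexx ?ler01.
apply/rowP => i; have [xi yi] := (ltW (x0 i), ltW (y0 i)).
by rewrite !mxE -tower_valE // wgeo_bool //; case: (c).
Qed.

Lemma tower_attained (e : nat -> R) x y (c : bool) cs f :
    (forall k, 0 <= e k) -> (x < f)%N -> (y < f)%N ->
  exists e', [/\ forall k, 0 <= e' k, forall k, (k < f)%N -> e' k = e k,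
    scalar_holds e' (tower x y (if c then y else x) cs f) &
    e' (tower_out (if c then y else x) cs f) =
      wgeo (e x) (e y) (weight c%:R cs)].
Proof.
move=> e0 xf yf; have zf : ((if c then y else x) < f)%N by case: (c).
have [e' [e'0 e'E e's e'o]] := tower_complete cs e0 xf yf zf.
exists e'; split=> //; rewrite e'o -tower_valE ?wgeo_bool //.
  by case: (c).
by case: (c); rewrite /= ?lexx ?ler01.
Qed.

(* [W = X #_(p / 2^l) Y] and [T = X #_(2^l / q) W], the latter encoded as
   [W >= T (T #_(q / 2^l - 1) X)^-1 T], that is [W = X #_(q / 2^l) T]. *)
Lemma geomean_system_half (a b p q l : nat) : (a < 2)%N -> (b < 2)%N ->
    (p <= 2 ^ l)%N -> (2 ^ l <= q < 2 ^ l.+1)%N -> (p <= q)%N ->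
  exists (s : seq constraint) (o : nat), [/\ (size s <= 2 * l + 1)%N,
    forall N (Z : nat -> 'M[C]_N) (xd yd : 'rV[R]_N), (0 < N)%N ->
      (forall k, Z k \is hermsymmx) -> sys_holds Z s ->
      loewner (Z a) (dgC xd) -> loewner (Z b) (dgC yd) ->
      (forall i, 0 < xd 0 i) -> (forall i, 0 < yd 0 i) ->
      loewner (Z o) (dgC (\row_i wgeo (xd 0 i) (yd 0 i) (p%:R / q%:R))) &
    forall e : nat -> R, (forall k, 0 <= e k) -> exists e',
      [/\ forall k, 0 <= e' k, forall k, (k < 2)%N -> e' k = e k,
        scalar_holds e' s & e' o = wgeo (e a) (e b) (p%:R / q%:R)]].
Proof.
move=> a2 b2 pl /andP[ql qu] pq.
have L0 : 0 < (2 ^+ l : R) by rewrite exprn_gt0.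
have qL : 2 ^+ l <= (q%:R : R) by rewrite -natrX ler_nat.
have q0 : 0 < (q%:R : R) by apply: lt_le_trans qL.
have qU : (q%:R : R) < 2 * 2 ^+ l by rewrite -exprS -natrX ltr_nat.
have pL : (p%:R : R) <= 2 ^+ l by rewrite -natrX ler_nat.
have pQ : (p%:R : R) <= q%:R by rewrite ler_nat.
have p0 : 0 <= (p%:R : R) by rewrite ler0n.
pose th : R := p%:R / q%:R; pose r : R := p%:R / 2 ^+ l.
(* The excess of [q / 2^l] over 1 is a dyadic weight in [0, 1], because [2^l <= q < 2^(l+1)]. *)
pose w : R := q%:R / 2 ^+ l - 1.
have th01 : 0 <= th <= 1.
  by rewrite divr_ge0 ?(ltW q0) //= ler_pdivrMr // mul1r.
have r01 : 0 <= r <= 1.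
  by rewrite divr_ge0 ?(ltW L0) //= ler_pdivrMr // mul1r.
have w01 : 0 <= w <= 1.
  rewrite /w subr_ge0 ler_pdivlMr // mul1r qL /= lerBlDr ler_pdivrMr //.
  by rewrite -[1 + 1]/(2%:R); exact: ltW.
have [c1 [cs1 [sz1 w1]]] := dyadic_weight pl.
have {}w1 : weight (c1%:R : R) cs1 = r by rewrite w1.
have ql2 : (q - 2 ^ l <= 2 ^ l)%N.
  by rewrite leq_subLR addnn -mul2n -expnS ltnW.
have [c2 [cs2 [sz2 w2]]] := dyadic_weight ql2.
have {}w2 : weight (c2%:R : R) cs2 = w.
  by rewrite w2 /w natrB // natrX; field; rewrite gt_eqF.
have key x y : 0 <= x -> 0 <= y ->
    wgeo x y th ^+ 2 = wgeo x y r * wgeo (wgeo x y th) x w.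
  move=> x0 y0; apply: wgeo_sqr => //.
  by rewrite /th /r /w; field; rewrite !gt_eqF.
(* Node layout: the arguments occupy 0 and 1, the first tower the next [l] nodes, [f] holds [T], and
   the second tower, from [f.+1] on, computes [T #_w X]. *)
pose f := (2 + l)%N.
pose z1 := if c1 then b else a.
pose t1 := tower a b z1 cs1 2; pose o1 := tower_out z1 cs1 2.
pose z2 := if c2 then a else f.
pose t2 := tower f a z2 cs2 f.+1; pose o2 := tower_out z2 cs2 f.+1.
have z12 : (z1 < 2)%N by rewrite /z1; case: (c1).
have o1f : (o1 < f)%N by rewrite /f -sz1; apply: tower_out_lt.
exists ((o1, f, o2) :: t1 ++ t2), f; split.
- by rewrite /= size_cat !size_tower sz1 sz2 mul2n -addnn addn1.
- move=> N Z xd yd N0 Zh sh Za Zb x0 y0.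
  have [sh1 sh2] : sys_holds Z t1 /\ sys_holds Z t2.
    by apply: sys_holds_cat => t ts; apply: sh; rewrite inE ts orbT.
  have sh0 := sh (o1, f, o2) (mem_head _ _).
  have Zo1 := tower_bound N0 Zh sh1 Za Zb x0 y0; rewrite w1 in Zo1.
  pose G := \row_i wgeo (xd 0 i) (yd 0 i) th.
  have G0 i : 0 < G 0 i by rewrite mxE wgeo_gt0.
  have [lam [Tl [u u0 Tu]]] := generalized_eigenvalue N0 (Zh f) G0.
  apply: (loewner_scale_le1 _ _ Tl) => [|i]; last exact: ltW.
  rewrite leNgt; apply/negP => lam1.
  have lam0 : 0 < lam by apply: lt_trans lam1.
  pose lG : 'rV[R]_N := lam *: G.
  have lG0 i : 0 < lG 0 i by rewrite mxE mulr_gt0.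
  have Tl' : loewner (Z f) (dgC lG) by rewrite dgCZ.
  have Zo2 := tower_bound N0 Zh sh2 Tl' Za lG0 x0; rewrite w2 in Zo2.
  pose mu := lam `^ ((1 - w) / 2).
  have mu0 : 0 < mu by rewrite powR_gt0.
  pose g : 'rV[R]_N := mu *: G.
  have g0 i : 0 < g 0 i by rewrite mxE mulr_gt0.
  have Tg : loewner (Z f) (dgC g).
    apply: (block_le_geomean N0 (Zh f) sh0 Zo1 Zo2) => // i.
      by rewrite mxE wgeo_gt0.
    rewrite ![in RHS]mxE !(mxE _ _ 0 i) exprMn key ?ltW //.
    have -> : mu ^+ 2 = lam `^ (1 - w).
      case/andP: w01 => w0' w1'.
      rewrite expr2 -powRD_nneg ?divr_ge0 ?subr_ge0 //.
      by congr (_ `^ _); field.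
    rewrite [wgeo (lam * _) _ _]/wgeo powRM ?wgeo_ge0 ?(ltW lam0) //.
    by rewrite [wgeo (wgeo _ _ _) _ _]/wgeo; ring.
  (* At the eigenvector [u] the bound [T <= mu G] reads [lam <= mu], whereas [mu <= lam^(1/2) < lam]
     for [lam > 1]. *)
  have := Tg u; rewrite /qf dgCZ sesqZm -/(qf (dgC G) u).
  have -> : sesq (Z f) u u = lam%:C * qf (dgC G) u.
    by rewrite /qf /sesq -!mulmxA Tu -scalemxAr mxE.
  rewrite ler_pM2r ?qf_dgC_gt0 // lecR leNgt => /negP; apply.
  case/andP: w01 => w0' w1'.
  apply: le_lt_trans (_ : lam `^ (2^-1) < lam).
    by rewrite ler_powR ?(ltW lam1) //; lra.
  rewrite powR12_sqrt ?(ltW lam0) // -{2}(sqr_sqrtr (ltW lam0)) expr2.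
  by rewrite ltr_pMr ?sqrtr_gt0 // -{1}sqrtr1 ltr_sqrt.
- move=> e e0.
  have [e1 [e10 e1E e1s e1o]] := tower_attained c1 cs1 e0 a2 b2.
  rewrite w1 in e1o; have ea := e1E _ a2.
  (* The node [f] receives the target mean; the values above [f] are provisional, since the second
     tower assigns them anew. *)
  pose e2 k := if (k < f)%N then e1 k else wgeo (e a) (e b) th.
  have e20 k : 0 <= e2 k by rewrite /e2; case: ifP => // _; rewrite wgeo_ge0.
  have e2E k : (k < f)%N -> e2 k = e1 k by rewrite /e2 => ->.
  have af : (a < f)%N by apply: leq_trans a2 _; rewrite leq_addr.
  have [e3 [e30 e3E e3s e3o]] :=
    tower_attained c2 cs2 e20 (leqnn f.+1) (ltnW af).
  have e2f : e2 f = wgeo (e a) (e b) th by rewrite /e2 ltnn.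
  rewrite w2 e2f (e2E a) // ea in e3o.
  have e3lt k : (k < f)%N -> e3 k = e1 k by move=> kf; rewrite e3E ?e2E // ltnW.
  have e3f : e3 f = wgeo (e a) (e b) th by rewrite e3E // e2f.
  exists e3; split => //.
  + move=> k k2; have kf : (k < f)%N by apply: leq_trans k2 _; rewrite leq_addr.
    by rewrite e3lt // e1E.
  + move=> t; rewrite inE => /predU1P[->/=|].
      by rewrite e3f e3o e3lt // e1o key.
    move: t; apply: scalar_holds_cat e3s => t tt.
    have := tower_lt a2 b2 z12 tt; rewrite sz1 => -[t11 t12 t13].
    by rewrite !e3lt //; exact: e1s.
Qed.

(** The arguments at nodes 0 and 1 are only assumed to lie below positive diagonal matrices, which
    also accommodates a singular argument. *)
Definition bounds_geomean (s : seq constraint) (o : nat) (th : R) :=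
  forall N (Z : nat -> 'M[C]_N) (xd yd : 'rV[R]_N), (0 < N)%N ->
    (forall k, Z k \is hermsymmx) -> sys_holds Z s ->
    loewner (Z 0%N) (dgC xd) -> loewner (Z 1%N) (dgC yd) ->
    (forall i, 0 < xd 0 i) -> (forall i, 0 < yd 0 i) ->
  loewner (Z o) (dgC (\row_i wgeo (xd 0 i) (yd 0 i) th)).

(** Scalars suffice here: the matrices to be attained are diagonal in one frame, and each diagonal
    entry gets its own solution. *)
Definition attains_geomean (s : seq constraint) (o : nat) (th : R) :=
  forall x y : R, 0 <= x -> 0 <= y -> exists e,
    [/\ forall k, 0 <= e k, e 0%N = x /\ e 1%N = y,
      scalar_holds e s & e o = wgeo x y th].

(** When [p > 2^l] the arguments are exchanged: [q - p <= 2^l] because [q < 2^(l+1)], and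
    [x #_(p/q) y = y #_((q-p)/q) x]. *)
Lemma geomean_system (p q : nat) : (0 < q)%N -> (p <= q)%N ->
  exists (s : seq constraint) (o : nat),
  [/\ (size s <= 2 * trunc_log 2 q + 1)%N,
    bounds_geomean s o (p%:R / q%:R) & attains_geomean s o (p%:R / q%:R)].
Proof.
move=> q0 pq; pose l := trunc_log 2 q.
have lq : (2 ^ l <= q < 2 ^ l.+1)%N by apply: trunc_log_bounds.
pose e0 (x y : R) k := if k is 0%N then x else if k is 1%N then y else 0.
have e00 x y : 0 <= x -> 0 <= y -> forall k, 0 <= e0 x y k.
  by move=> x0 y0 [|[|k]] /=.
have [pl|pl] := leqP p (2 ^ l).
  have [s [o [sz snd cpl]]] :=
    @geomean_system_half 0 1 p q l isT isT pl lq pq.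
  exists s, o; split; [exact: sz | exact: snd | move=> x y x0 y0].
  have [e [e0' eE es eo]] := cpl _ (e00 _ _ x0 y0).
  by exists e; split => //; split; rewrite eE.
have pl' : (q - p <= 2 ^ l)%N.
  case/andP: lq => _ lq; rewrite leq_subLR ltnW // (leq_trans lq) //.
  by rewrite expnS mul2n -addnn leq_add2r ltnW.
have wE : (q - p)%:R / q%:R = 1 - p%:R / q%:R :> R.
  by rewrite natrB //; field; rewrite pnatr_eq0 -lt0n.
have [s [o [sz snd cpl]]] :=
  @geomean_system_half 1 0 (q - p) q l isT isT pl' lq (leq_subr _ _).
exists s, o; split; first exact: sz.
  move=> N Z xd yd N0 Zh sh Z0 Z1 x0 y0.
  have := snd N Z yd xd N0 Zh sh Z1 Z0 y0 x0; rewrite wE.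
  suff -> : \row_i wgeo (yd 0 i) (xd 0 i) (1 - p%:R / q%:R) =
    \row_i wgeo (xd 0 i) (yd 0 i) (p%:R / q%:R) by [].
  by apply/rowP => i; rewrite !mxE wgeoC.
move=> x y x0 y0; have [e [e0' eE es eo]] := cpl _ (e00 _ _ x0 y0).
by exists e; split => //; [split; rewrite eE|rewrite eo wE wgeoC].
Qed.

End DyadicTower.

(** * Scalar Young inequalities and their equality case *)

Section Young.
Variable R : realType.
Implicit Types (t y b : R).

(** Tangent line of the exponential at the logarithm [M] of the geometric mean:
    [c >= expR M (1 + ln c - M)] for [c = y, b], and the weighted corrections [ln c - M] add up to
    0. The weights 0 and 1 are split off first because 0 to the power 0 is 1. *)
Lemma weighted_amgm t y b : 0 <= t <= 1 -> 0 <= y -> 0 <= b ->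
  y `^ t * b `^ (1 - t) <= t * y + (1 - t) * b.
Proof.
move=> /andP[t0 t1] y0 b0; have t1' : 0 <= 1 - t by rewrite subr_ge0.
have [->|tN0] := eqVneq t 0.
  by rewrite subr0 powRr0 powRr1 // !mul1r mul0r add0r.
have [->|tN1] := eqVneq t 1.
  by rewrite subrr powRr0 powRr1 // mulr1 mul1r mul0r addr0.
have [->|yN0] := eqVneq y 0.
  by rewrite powR0 // mul0r mulr0 add0r mulr_ge0.
have [->|bN0] := eqVneq b 0.
  by rewrite powR0 ?subr_eq0 1?eq_sym // mulr0 mulr0 addr0 mulr_ge0.
have {}y0 : 0 < y by rewrite lt0r yN0.
have {}b0 : 0 < b by rewrite lt0r bN0.
pose M := t * ln y + (1 - t) * ln b.
have expE (c : R) : 0 < c -> expR M * (1 + (ln c - M)) <= c.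
  move=> c0; have cE : expR M * expR (ln c - M) = c.
    by rewrite -expRD subrKC lnK.
  rewrite -[leRHS]cE.
  by rewrite ler_pM2l ?expR_gt0 ?expR_ge1Dx.
have -> : y `^ t * b `^ (1 - t) = expR M.
  by rewrite /powR !gt_eqF // -expRD.
have := lerD (ler_wpM2l t0 (expE _ y0)) (ler_wpM2l t1' (expE _ b0)).
apply: le_trans; rewrite le_eqVlt; apply/orP; left; apply/eqP.
by rewrite /M; ring.
Qed.

Lemma young_le t y b : 0 < t <= 1 -> 0 <= y -> 0 <= b ->
  y * b `^ (1 - t) <= t * y `^ t^-1 + (1 - t) * b.
Proof.
move=> /andP[t0 t1] y0 b0.
have := @weighted_amgm t (y `^ t^-1) b; rewrite -powRrM mulVf ?gt_eqF //.
by rewrite powRr1 //; apply; rewrite ?powR_ge0 // ltW.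
Qed.

(** AM-GM with weight [1/t] on [y b^(1-t)] and the rest on [b]: the weighted geometric mean is
    [y^(1/t)]. *)
Lemma young_ge_pos t y b : 1 <= t -> 0 <= y -> 0 < b ->
  t * y `^ t^-1 + (1 - t) * b <= y * b `^ (1 - t).
Proof.
move=> t1 y0 b0; have t0 : 0 < t by apply: lt_le_trans t1.
have tV : 0 <= t^-1 <= 1 by rewrite invr_ge0 ltW //= invf_le1.
have yb0 : 0 <= y * b `^ (1 - t) by rewrite mulr_ge0 ?powR_ge0.
have := weighted_amgm tV yb0 (ltW b0).
have -> : (y * b `^ (1 - t)) `^ t^-1 * b `^ (1 - t^-1) = y `^ t^-1.
  rewrite powRM ?powR_ge0 // -mulrA -powRrM -powRD ?(gt_eqF b0) ?implybT //.
  have -> : (1 - t) * t^-1 + (1 - t^-1) = 0 by field; rewrite gt_eqF.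
  by rewrite powRr0 mulr1.
move=> /(ler_wpM2l (ltW t0)); rewrite mulrDr !mulrA divff ?gt_eqF // mul1r => h.
rewrite -lerBrDr; apply: le_trans h _.
rewrite le_eqVlt; apply/orP; left; apply/eqP; field; by rewrite gt_eqF.
Qed.

(** AM-GM with weight [1/(1-t)] on [y b^(1-t)] and the rest on [y^(1/t)]: the weighted geometric
    mean is [b]. *)
Lemma young_ge_neg t y b : t < 0 -> 0 < y -> 0 <= b ->
  t * y `^ t^-1 + (1 - t) * b <= y * b `^ (1 - t).
Proof.
move=> t0 y0 b0; have s0 : 0 < 1 - t by rewrite subr_gt0 (lt_trans t0).
have sV : 0 <= (1 - t)^-1 <= 1.
  by rewrite invr_ge0 ltW //= invf_le1 // lerDl oppr_ge0 ltW.
have yb0 : 0 <= y * b `^ (1 - t) by rewrite mulr_ge0 ?powR_ge0 // ltW.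
have := weighted_amgm sV yb0 (powR_ge0 y t^-1).
have -> : (y * b `^ (1 - t)) `^ (1 - t)^-1 *
    (y `^ t^-1) `^ (1 - (1 - t)^-1) = b.
  rewrite powRM ?powR_ge0 ?(ltW y0) // mulrAC -powRrM -!powRrM.
  rewrite -powRD ?(gt_eqF y0) ?implybT //.
  have -> : (1 - t)^-1 + t^-1 * (1 - (1 - t)^-1) = 0.
    by field; rewrite (lt_eqF t0) (gt_eqF s0).
  by rewrite powRr0 mul1r divff ?gt_eqF // powRr1.
move=> /(ler_wpM2l (ltW s0)); rewrite mulrDr !mulrA divff ?gt_eqF // mul1r => h.
rewrite -lerBrDl; apply: le_trans h _.
rewrite le_eqVlt; apply/orP; left; apply/eqP; field; by rewrite gt_eqF.
Qed.

(** The choice [b = y^(1/t)] is the equality case of the Young inequalities above. *)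
Lemma young_eq t y : t != 0 -> 0 <= y -> (t < 0 -> 0 < y) ->
  y * (y `^ t^-1) `^ (1 - t) = y `^ t^-1.
Proof.
move=> tN0 y0 tn; have [yz|yN0] := eqVneq y 0.
  by rewrite yz mul0r powR0 ?invr_eq0.
rewrite -powRrM -{1}(powRr1 y0) -powRD ?yN0 ?implybT //.
by congr (_ `^ _); field.
Qed.

End Young.

(** * Tensor products and vectorization *)

Section TensorProducts.
Variable R : realType.
Local Notation C := R[i].

(** Row-major vectorization, for which [A (x) B] acts as [X |-> A X B^T]; this is the source of the
    transpose of [B]. *)
Definition vecc n m (X : 'M[C]_(n, m)) : 'cV[C]_(n * m) :=
  \col_u X (mxtens_unindex u).1 (mxtens_unindex u).2.

Lemma sum_mxtens (V : nmodType) n m (F : 'I_n -> 'I_m -> V) :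
  \sum_(u < n * m) F (mxtens_unindex u).1 (mxtens_unindex u).2 =
  \sum_i \sum_j F i j.
Proof.
rewrite pair_bigA (reindex (@mxtens_index n m)); last first.
  by exists (@mxtens_unindex n m) => u _;
    rewrite ?mxtens_indexK ?mxtens_unindexK.
by apply: eq_bigr => ij _; rewrite mxtens_indexK.
Qed.

Lemma tens_vecc n m n' m' (A : 'M[C]_(n', n)) (B : 'M[C]_(m', m)) X :
  (A *t B) *m vecc X = vecc (A *m X *m B^T).
Proof.
apply/colP => u; rewrite !mxE.
under eq_bigr do rewrite !mxE.
rewrite (sum_mxtens (fun i j => A (mxtens_unindex u).1 i *
  B (mxtens_unindex u).2 j * X i j)) exchange_big /=.
apply: eq_bigr => j _; rewrite !mxE mulr_suml.
by apply: eq_bigr => i _; rewrite mulrAC.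
Qed.

Lemma adj_tens n m n' m' (A : 'M[C]_(n', n)) (B : 'M[C]_(m', m)) :
  (A *t B) ^t* = A ^t* *t B ^t*.
Proof. by rewrite trmx_tens map_mxT. Qed.

Lemma mxtens_unindex_eq n m (u v : 'I_(n * m)) :
  (u == v) = ((mxtens_unindex u).1 == (mxtens_unindex v).1) &&
             ((mxtens_unindex u).2 == (mxtens_unindex v).2).
Proof. by rewrite -(inj_eq (can_inj (@mxtens_unindexK n m))) -pair_eqE. Qed.

Lemma tens_dgC1 n m (a : 'rV[R]_n) :
  dgC a *t (1%:M : 'M[C]_m) = dgC (\row_u a 0 (mxtens_unindex u).1).
Proof.
apply/matrixP => u v; rewrite !mxE mxtens_unindex_eq.
by do 2 case: eqP => _;
  rewrite /= ?mulr1n ?mulr0n ?mulr0 ?mulr1 ?mul0r.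
Qed.

Lemma tens_1dgC n m (b : 'rV[R]_m) :
  (1%:M : 'M[C]_n) *t dgC b = dgC (\row_u b 0 (mxtens_unindex u).2).
Proof.
apply/matrixP => u v; rewrite !mxE mxtens_unindex_eq.
by do 2 case: eqP => _;
  rewrite /= ?mulr1n ?mulr0n ?mulr0 ?mul1r ?mul0r.
Qed.

Lemma herm_tens n m (A : 'M[C]_n) (B : 'M[C]_m) :
  A \is hermsymmx -> B \is hermsymmx -> A *t B \is hermsymmx.
Proof. by move=> /hermP AE /hermP BE; apply/hermP; rewrite adj_tens AE BE. Qed.

End TensorProducts.

(** * Positivity of block and bordered matrices *)

Section BlockPositivity.
Variable R : realType.
Local Notation C := R[i].

(** Multiplied by [a > 0], the form is a square plus [(a c - |u|^2) |y|^2]; and [a = 0] forces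
    [u = 0]. *)
Lemma quad_ge0 (a c : R) (u x y : C) : 0 <= a -> 0 <= c -> nsq u <= a * c ->
  0 <= a%:C * (Num.conj x * x) + Num.conj x * Num.conj u * y +
    (Num.conj y * u * x + c%:C * (Num.conj y * y)).
Proof.
move=> a0 c0 uac; have [az|aN0] := eqVneq a 0.
  have u0 : u = 0.
    apply: nsq_eq0; apply/eqP.
    by rewrite eq_le nsq_ge0 (le_trans uac) // az mul0r.
  rewrite az u0 !rmorph0 !(mul0r, mulr0, add0r) normCK'.
  by rewrite scaled_normc2_ge0.
have {}a0 : 0 < a by rewrite lt0r aN0.
have aC : (0 : C) < a%:C by rewrite ltr0c.
rewrite -(pmulr_rge0 _ aC).
have : 0 <= `|a%:C * x + Num.conj u * y| ^+ 2 + (a * c - nsq u)%:C * `|y| ^+ 2.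
  by rewrite addr_ge0 ?exprn_ge0 ?normr_ge0 // scaled_normc2_ge0 // subr_ge0.
rewrite -!normCK' rmorphB rmorphM /= -nsqE -normCK' !rmorphD !rmorphM /=.
rewrite conj_rc conjCK.
by congr (0 <= _); ring.
Qed.

(** Up to a permutation the block matrix is a direct sum of 2 x 2 matrices, one for each index. *)
Lemma psd_block_dgC n (a r c : 'rV[R]_n) :
  (forall i, 0 <= a 0 i) -> (forall i, 0 <= c 0 i) ->
  (forall i, r 0 i ^+ 2 <= a 0 i * c 0 i) ->
  psdmx (block_mx (dgC a) (dgC r) (dgC r) (dgC c)).
Proof.
move=> a0 c0 rac; apply/psdmxP; split.
  rewrite -{2}(_ : (dgC r) ^t* = dgC r); last exact/hermP/dgC_herm.
  exact: herm_block (dgC_herm _) (dgC_herm _).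
move=> v; rewrite -[v]vsubmxK /qf sesq_block !sesq_dgC -!big_split /=.
apply: sumr_ge0 => i _.
set x := usubmx v i 0; set y := dsubmx v i 0.
have := @quad_ge0 (a 0 i) (c 0 i) (r 0 i)%:C x y (a0 i) (c0 i).
rewrite {1}/nsq /= expr0n /= addr0 conj_rc => /(_ (rac i)).
by congr (0 <= _); ring.
Qed.

(** For positive definite [T], positivity amounts by Schur complement to [c >= u^* T^-1 u]; the
    bordered form also covers a singular [T]. *)
Definition border n (c : R) (u : 'cV[C]_n) (T : 'M[C]_n) : 'M[C]_(1 + n) :=
  block_mx (c%:C)%:M (u ^t*) u T.

Lemma border_herm n c (u : 'cV[C]_n) T :
  T \is hermsymmx -> border c u T \is hermsymmx.
Proof.
move=> Th; rewrite /border -{2}[u]trmxCK; apply: herm_block => //.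
by apply/hermP; rewrite tr_scalar_mx map_scalar_mx /= conj_rc.
Qed.

Lemma qf_border n c (u : 'cV[C]_n) T z v :
  qf (border c u T) (col_mx z v) = c%:C * `|z 0 0| ^+ 2 +
    Num.conj (z 0 0) * (u ^t* *m v) 0 0 +
    ((v ^t* *m u) 0 0 * z 0 0 + qf T v).
Proof.
rewrite /qf /border sesq_block; congr (_ + _ + (_ + _)).
- by rewrite /sesq mul_mx_scalar -scalemxAl mxE; congr (_ * _);
     rewrite mxE big_ord1 adjE normCK'.
- by rewrite /sesq -mulmxA mxE big_ord1 adjE.
- by rewrite /sesq mxE big_ord1.
Qed.

(** Splitting the corner writes the form as a sum over [i] of 2 x 2 forms that share their first
    coordinate. *)
Lemma psd_border_dgC n (cs g : 'rV[R]_n) (u : 'cV[C]_n) :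
  (forall i, 0 <= cs 0 i) -> (forall i, 0 <= g 0 i) ->
  (forall i, nsq (u i 0) <= cs 0 i * g 0 i) ->
  psdmx (border (\sum_i cs 0 i) u (dgC g)).
Proof.
move=> c0 g0 ucg; apply/psdmxP; split; first exact/border_herm/dgC_herm.
move=> v; rewrite -[v]vsubmxK qf_border qf_dgC rmorph_sum.
rewrite !mulr_suml !mxE mulr_suml mulr_sumr -!big_split /=.
apply: sumr_ge0 => i _; rewrite !adjE -!normCK'.
have := @quad_ge0 (cs 0 i) (g 0 i) (u i 0) (usubmx v 0 0) (dsubmx v i 0)
  (c0 i) (g0 i).
by rewrite [usubmx v _ _]mxE => /(_ (ucg i)); congr (0 <= _); ring.
Qed.

Lemma border_lower n (c : R) (g : 'rV[R]_n) (u : 'cV[C]_n) T :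
    psdmx (border c u T) -> loewner T (dgC g) -> (forall i, 0 < g 0 i) ->
  \sum_i nsq (u i 0) / g 0 i <= c.
Proof.
move=> /psdmxP[_ Bp] Tg g0.
(* With [T] replaced by its bound, the form at [(1, v)] is smallest for this [v], where it equals
   [c] minus the sum. *)
pose v : 'cV[C]_n := \col_i ((- (g 0 i)^-1)%:C * u i 0).
have := le_trans (Bp (col_mx (const_mx 1) v)) _; rewrite qf_border !mxE normr1.
rewrite expr1n rmorph1 mulr1 mul1r mulr1 => h.
have vE i : v i 0 = (- (g 0 i)^-1)%:C * u i 0 by rewrite mxE.
have : 0 <= c%:C + (\sum_i (- (nsq (u i 0) / g 0 i)))%:C.
  apply: h; rewrite -addrA lerD2l.
  apply: le_trans (lerD (lexx _) (lerD (lexx _) (Tg v))) _.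
  rewrite qf_dgC_nsq !rmorph_sum -!big_split /=; apply: ler_sum => i _.
  rewrite !adjE vE nsqZ rmorphM /= conj_rc.
  have -> : Num.conj (u i 0) * ((- (g 0 i)^-1)%:C * u i 0) +
     ((- (g 0 i)^-1)%:C * Num.conj (u i 0) * u i 0 +
      (g 0 i * ((- (g 0 i)^-1) ^+ 2 * nsq (u i 0)))%:C) =
     (- (g 0 i)^-1 * nsq (u i 0) + (- (g 0 i)^-1 * nsq (u i 0) +
       g 0 i * ((- (g 0 i)^-1) ^+ 2 * nsq (u i 0))))%:C.
    by rewrite !rmorphD !rmorphM /= -nsqE -normCK'; ring.
  rewrite lecR le_eqVlt; apply/orP; left; apply/eqP; field.
  by rewrite gt_eqF.
by rewrite -rmorphD ler0c sumrN subr_ge0.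
Qed.

Lemma border_rot n (V : 'M[C]_n) c u T :
  psdmx (border c u T) -> psdmx (border c (V *m u) (V *m T *m V ^t*)).
Proof.
move=> /(psd_cong (block_mx 1%:M 0 0 (V ^t*))).
rewrite tr_block_mx map_block_mx trmxCK trmx1 map_mx1 !trmx0 !map_mx0.
rewrite /border !mulmx_block !(mul1mx, mulmx1, mul0mx, mulmx0, addr0, add0r).
by rewrite adjM.
Qed.

Lemma psd_block_cong n (V A B D : 'M[C]_n) : psdmx (block_mx A B B D) ->
  psdmx (block_mx (V ^t* *m A *m V) (V ^t* *m B *m V)
                  (V ^t* *m B *m V) (V ^t* *m D *m V)).
Proof.
move=> /(psd_cong (block_mx V 0 0 V)).
rewrite tr_block_mx map_block_mx !trmx0 !map_mx0.
rewrite !mulmx_block !mul0mx !mulmx0 !addr0 !add0r.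
by rewrite ?mul0mx ?mulmx0 ?addr0 ?add0r.
Qed.

Lemma sys_cong n (V : 'M[C]_n) (Z : nat -> 'M[C]_n) s :
  sys_holds Z s -> sys_holds (fun k => V ^t* *m Z k *m V) s.
Proof. by move=> h t ts; exact: psd_block_cong (h t ts). Qed.

Lemma qf_rot n (V T : 'M[C]_n) v : V \is unitarymx ->
  qf (V *m T *m V ^t*) (V *m v) = qf T v.
Proof.
move=> /unitary_adjK[_ VV]; rewrite -{1}[V]trmxCK qf_cong.
by rewrite mulmxA VV mul1mx.
Qed.

End BlockPositivity.

(** * Trace inequalities for [Upsilon] *)

Section UpsilonBounds.
Variables (R : realType) (n m : nat) (K : 'M[R[i]]_(n, m)) (t : R).
Local Notation C := R[i].

Definition inner (A : 'M[C]_n) : 'M[C]_m := K ^t* *m mxpowR A t *m K.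

Lemma Upsilon_sum A :
  Upsilon K t A = \sum_j (real_spectrum (inner A) 0 j) `^ t^-1.
Proof. exact: tr_mxpowR. Qed.

Lemma inner_psd A : psdmx (inner A).
Proof.
rewrite /inner mxpowRE; do 2 apply: psd_cong.
by apply: psd_dgC => i; rewrite mxE powR_ge0.
Qed.

(** The coordinates of [vecc K] in the product frame [spectralmx A (x) W], arranged as a matrix. *)
Definition coords (A : 'M[C]_n) (W : 'M[C]_m) : 'M[C]_(n, m) :=
  spectralmx A *m K *m W^T.

(** Both sides are the form of [inner A] at column [j] of [W^T], expanded in the eigenbasis of [A]
    and in that of [inner A]. *)
Lemma coords_inner A W j :
  \sum_i (real_spectrum A 0 i) `^ t * nsq (coords A W i j) =
  \sum_l real_spectrum (inner A) 0 l *
    nsq ((spectralmx (inner A) *m W^T) l j).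
Proof.
apply: complexI; have -> : (\sum_i (real_spectrum A 0 i) `^ t *
    nsq (coords A W i j))%:C = qf (inner A) (W^T *m delta_mx j 0).
  rewrite /inner qf_cong mxpowRE qf_cong qf_dgC_nsq; congr (_%:C).
  apply: eq_bigr => i _; rewrite [X in _ = X * _]mxE; congr (_ * nsq _).
  by rewrite /coords !mulmxA -colE [RHS]mxE.
rewrite {1}(spectral_decomposition (inner_psd A).1) qf_cong qf_dgC_nsq.
congr (_%:C); apply: eq_bigr => l _; congr (_ * nsq _).
by rewrite mulmxA -colE [LHS]mxE.
Qed.

Lemma coords_sum A W (h : 'I_m -> R) :
  \sum_i \sum_j (real_spectrum A 0 i) `^ t * h j * nsq (coords A W i j) =
  \sum_l \sum_j real_spectrum (inner A) 0 l * h j *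
    nsq ((spectralmx (inner A) *m W^T) l j).
Proof.
rewrite exchange_big [RHS]exchange_big /=; apply: eq_bigr => j _.
transitivity (h j * \sum_i (real_spectrum A 0 i) `^ t * nsq (coords A W i j)).
  by rewrite mulr_sumr; apply: eq_bigr => i _; ring.
by rewrite coords_inner mulr_sumr; apply: eq_bigr => i _; ring.
Qed.

(* The squared moduli of a unitary matrix are doubly stochastic, so a scalar
   Young inequality sums up to the trace inequality. *)
Lemma young_trace_sum A W (b : 'I_m -> R) : W \is unitarymx ->
  \sum_l \sum_j (t * (real_spectrum (inner A) 0 l) `^ t^-1 + (1 - t) * b j) *
    nsq ((spectralmx (inner A) *m W^T) l j) =
  t * Upsilon K t A + (1 - t) * \sum_j b j.
Proof.
move=> Wu; set M := _ *m W^T; have Mu : M \is unitarymx.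
  by rewrite mul_unitarymx ?spectral_unitarymx ?trmx_unitary.
under eq_bigr do under eq_bigr do rewrite mulrDl.
under eq_bigr do rewrite big_split /=.
rewrite big_split /= Upsilon_sum !mulr_sumr; congr (_ + _).
  by apply: eq_bigr => l _; rewrite -mulr_sumr unitary_row_nsq // mulr1.
rewrite exchange_big /=; apply: eq_bigr => j _.
by rewrite -mulr_sumr unitary_col_nsq // mulr1.
Qed.

Lemma trace_young_le A W (b h : 'I_m -> R) : W \is unitarymx ->
  (forall l j, real_spectrum (inner A) 0 l * h j <=
     t * (real_spectrum (inner A) 0 l) `^ t^-1 + (1 - t) * b j) ->
  \sum_i \sum_j (real_spectrum A 0 i) `^ t * h j * nsq (coords A W i j) <=
  t * Upsilon K t A + (1 - t) * \sum_j b j.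
Proof.
move=> Wu hyp; rewrite coords_sum -(young_trace_sum A b Wu).
by do 2 apply: ler_sum => ? _; rewrite ler_wpM2r ?nsq_ge0.
Qed.

Lemma trace_young_ge A W (b h : 'I_m -> R) : W \is unitarymx ->
  (forall l j, t * (real_spectrum (inner A) 0 l) `^ t^-1 + (1 - t) * b j <=
     real_spectrum (inner A) 0 l * h j) ->
  t * Upsilon K t A + (1 - t) * \sum_j b j <=
  \sum_i \sum_j (real_spectrum A 0 i) `^ t * h j * nsq (coords A W i j).
Proof.
move=> Wu hyp; rewrite coords_sum -(young_trace_sum A b Wu).
by do 2 apply: ler_sum => ? _; rewrite ler_wpM2r ?nsq_ge0.
Qed.

End UpsilonBounds.

(** * The common eigenframe of the two commuting operators *)

Section TensorFrame.
Variable R : realType.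
Local Notation C := R[i].

Lemma unitary_tens n m (U : 'M[C]_n) (W : 'M[C]_m) :
  U \is unitarymx -> W \is unitarymx -> U *t W \is unitarymx.
Proof.
move=> /unitary_adjK[UU _] /unitary_adjK[WW _]; apply/unitarymxP.
rewrite adj_tens tensmx_mul UU WW; apply/matrixP => u v.
by rewrite !mxE mxtens_unindex_eq; do 2 case: eqP => _;
  rewrite ?mulr1 ?mulr0 ?mul0r.
Qed.

Lemma tens_frame_l n m (U : 'M[C]_n) (W : 'M[C]_m) (a : 'rV[R]_n) :
    W \is unitarymx ->
  (U ^t* *m dgC a *m U) *t (1%:M : 'M[C]_m) =
  (U *t W) ^t* *m dgC (\row_u a 0 (mxtens_unindex u).1) *m (U *t W).
Proof.
move=> /unitary_adjK[_ WW].
by rewrite -(tens_dgC1 m) adj_tens !tensmx_mul mulmx1 WW.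
Qed.

Lemma tens_frame_r n m (U : 'M[C]_n) (W : 'M[C]_m) (b : 'rV[R]_m) :
    U \is unitarymx ->
  (1%:M : 'M[C]_n) *t (W ^t* *m dgC b *m W) =
  (U *t W) ^t* *m dgC (\row_u b 0 (mxtens_unindex u).2) *m (U *t W).
Proof.
move=> /unitary_adjK[_ UU].
by rewrite -(tens_1dgC n) adj_tens !tensmx_mul mulmx1 UU.
Qed.

Lemma unframe n (V D : 'M[C]_n) : V \is unitarymx ->
  V *m (V ^t* *m D *m V) *m V ^t* = D.
Proof.
move=> /unitary_adjK[VV _].
by rewrite !mulmxA VV mul1mx -mulmxA VV mulmx1.
Qed.

(** In the frame [V] both arguments are diagonal. The majorants [x'] and [y'] provide the positive
    entries that [bounds_geomean] asks for when an argument is singular. *)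
Lemma geomean_frame_le N s o th (Z : nat -> 'M[C]_N) V (x y x' y' : 'rV[R]_N) :
    (0 < N)%N -> bounds_geomean s o th -> V \is unitarymx ->
    (forall k, Z k \is hermsymmx) -> sys_holds Z s ->
    Z 0%N = V ^t* *m dgC x *m V -> Z 1%N = V ^t* *m dgC y *m V ->
    (forall i, x 0 i <= x' 0 i) -> (forall i, y 0 i <= y' 0 i) ->
    (forall i, 0 < x' 0 i) -> (forall i, 0 < y' 0 i) ->
  loewner (V *m Z o *m V ^t*) (dgC (\row_i wgeo (x' 0 i) (y' 0 i) th)).
Proof.
move=> N0 bnd Vu Zh Zs Z0 Z1 xx' yy' x'0 y'0.
pose Z' k := V *m Z k *m V ^t*.
have Zh' k : Z' k \is hermsymmx by rewrite /Z' -{1}[V]trmxCK; exact: herm_cong.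
have Z0' : loewner (Z' 0%N) (dgC x').
  by rewrite /Z' Z0 (unframe _ Vu); exact: dgC_le.
have Z1' : loewner (Z' 1%N) (dgC y').
  by rewrite /Z' Z1 (unframe _ Vu); exact: dgC_le.
have Zs' : sys_holds Z' s.
  by move=> t ts; have := sys_cong (V ^t*) Zs ts; rewrite trmxCK.
exact: bnd _ Z' _ _ N0 Zh' Zs' Z0' Z1' x'0 y'0.
Qed.

(** One scalar solution for each diagonal entry, assembled into diagonal matrices and carried over
    by congruence with [V]. *)
Lemma geomean_frame_attained N s o th (V : 'M[C]_N) (x y : 'rV[R]_N) :
    attains_geomean s o th ->
    (forall i, 0 <= x 0 i) -> (forall i, 0 <= y 0 i) ->
  exists Z, [/\ forall k, Z k \is hermsymmx, sys_holds Z s,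
    Z 0%N = V ^t* *m dgC x *m V, Z 1%N = V ^t* *m dgC y *m V &
    Z o = V ^t* *m dgC (\row_i wgeo (x 0 i) (y 0 i) th) *m V].
Proof.
move=> att x0 y0.
have /fin_all_exists[e he] : forall i : 'I_N, exists e : nat -> R,
    [/\ forall k, 0 <= e k, e 0%N = x 0 i /\ e 1%N = y 0 i,
      scalar_holds e s & e o = wgeo (x 0 i) (y 0 i) th].
  by move=> i; apply: att.
have e_node k (z : 'rV[R]_N) : (forall i, e i k = z 0 i) -> \row_i e i k = z.
  by move=> ez; apply/rowP => i; rewrite mxE.
exists (fun k => V ^t* *m dgC (\row_i e i k) *m V); split.
- by move=> k; apply/herm_cong/dgC_herm.
- apply: (@sys_cong _ _ V (fun k => dgC (\row_i e i k))) => t ts.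
  by apply: psd_block_dgC => i; have [e0 _ es _] := he i; rewrite !mxE ?e0 ?es.
- by rewrite (e_node _ x) // => i; have [_ [-> _] _ _] := he i.
- by rewrite (e_node _ y) // => i; have [_ [_ ->] _ _] := he i.
- rewrite (e_node _ (\row_i wgeo (x 0 i) (y 0 i) th)) // => i.
  by rewrite mxE; have [_ _ _ ->] := he i.
Qed.

Lemma rowE n (f : 'I_n -> R) i : (\row_j f j) 0 i = f i.
Proof. exact: mxE. Qed.

Lemma veccE n m (X : 'M[C]_(n, m)) u :
  vecc X u 0 = X (mxtens_unindex u).1 (mxtens_unindex u).2.
Proof. exact: mxE. Qed.

End TensorFrame.

(** * Soundness: feasible auxiliary matrices bound [t Upsilon_t(A)] *)

Section Soundness.
Variables (R : realType) (n m : nat) (K : 'M[R[i]]_(n, m)) (t : R).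
Local Notation C := R[i].
Hypotheses (n0 : (0 < n)%N) (m0 : (0 < m)%N).
Variables (A : 'M[C]_n) (B : 'M[C]_m).
Hypotheses (Apd : pdmx A) (Bh : B \is hermsymmx).
Hypothesis Bpsd : psdmx ((1%:M : 'M[C]_n) *t B).
Variables (s : seq constraint) (o : nat) (Z : nat -> 'M[C]_(n * m)).
Hypotheses (Zh : forall k, Z k \is hermsymmx) (Zs : sys_holds Z s).

Let a := real_spectrum A.
Let b := real_spectrum B.
Let W := spectralmx B.
Let V := spectralmx A *t W.
Let rowA (f : 'rV[R]_n) : 'rV[R]_(n * m) := \row_u f 0 (mxtens_unindex u).1.
Let rowB (f : 'rV[R]_m) : 'rV[R]_(n * m) := \row_u f 0 (mxtens_unindex u).2.

Let Wu : W \is unitarymx. Proof. exact: spectral_unitarymx. Qed.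
Let Vu : V \is unitarymx.
Proof. by apply: unitary_tens => //; exact: spectral_unitarymx. Qed.
Let a0 i : 0 < a 0 i. Proof. exact: real_spectrum_gt0. Qed.
Let N0 : (0 < n * m)%N. Proof. by rewrite muln_gt0 n0. Qed.

Let opA : A *t (1%:M : 'M[C]_m) = V ^t* *m dgC (rowA a) *m V.
Proof. by rewrite {1}(spectral_decomposition Apd.1) (tens_frame_l _ _ Wu). Qed.

Let opB : (1%:M : 'M[C]_n) *t B = V ^t* *m dgC (rowB b) *m V.
Proof.
rewrite {1}(spectral_decomposition Bh).
exact: tens_frame_r (spectral_unitarymx A).
Qed.

Let b0 j : 0 <= b 0 j.
Proof.
have := psd_cong (V ^t*) Bpsd; rewrite trmxCK opB unframe // => /psdmxP[_].
(* In the frame [V], the form of [1 (x) B] at a basis vector of second index [j] is [b_j]; [n > 0]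
   supplies a first index. *)
pose u := mxtens_index (Ordinal n0, j).
move=> /(_ (delta_mx u 0)); rewrite qf_dgC_nsq ler0c (bigD1 u) //= big1.
  rewrite [delta_mx _ _ _ _]mxE !eqxx mxE mxtens_indexK /nsq /=.
  by rewrite expr1n expr0n /= !addr0 mulr1.
move=> v vu; rewrite [delta_mx _ _ _ _]mxE (negbTE vu) /nsq /=.
by rewrite expr0n /= addr0 mulr0.
Qed.

Let trB : complex.Re (\tr B) = \sum_j b 0 j.
Proof.
by rewrite {1}(spectral_decomposition Bh) tr_cong_dgC ?spectral_unitarymx.
Qed.

Let k := coords K A W.

Let VK : V *m vecc K = vecc k.
Proof. exact: tens_vecc. Qed.

Let VDK D : V *m (V ^t* *m D *m V *m vecc K) = D *m vecc k.
Proof.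
have [VV _] := unitary_adjK Vu.
by rewrite !mulmxA VV mul1mx -mulmxA VK.
Qed.

(** [B] may be singular: shifting its spectrum by a small positive [e] supplies positive
    majorants. *)
Let be (e : R) : 'rV[R]_m := \row_j (b 0 j + e).

Let be_gt0 e j : 0 < e -> 0 < be e 0 j.
Proof. by move=> e0; rewrite [be _ _ _]rowE ltr_wpDl. Qed.

Let be_ge e j : 0 < e -> b 0 j <= be e 0 j.
Proof. by move=> e0; rewrite [be _ _ _]rowE lerDl ltW. Qed.

Let sum_be e : \sum_j be e 0 j = \sum_j b 0 j + m%:R * e.
Proof.
under eq_bigr do rewrite [be _ _ _]rowE.
by rewrite big_split /= sumr_const card_ord [m%:R * e]mulr_natl.
Qed.

(** The form of [Z o] at [vecc K] is at most the sum of [a_i^t (b_j + d)^(1-t) |k_ij|^2], to which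
    the trace form of Young's inequality applies. *)
Lemma hypograph_sound : 0 < t <= 1 -> bounds_geomean s o t ->
  Z 0%N = 1%:M *t B -> Z 1%N = A *t 1%:M ->
  complex.Re (qf (Z o) (vecc K)) <=
    t * Upsilon K t A + (1 - t) * complex.Re (\tr B).
Proof.
move=> t01 bnd Z0 Z1; have [t0 t1] := andP t01; apply/ler_addgt0Pr => e e0.
(* The shift by [d] adds [m d = e] to the trace of [B], hence at most [e] to the bound. *)
pose d := e / m%:R; have mR : 0 < (m%:R : R) by rewrite ltr0n.
have d0 : 0 < d by rewrite divr_gt0.
rewrite opB in Z0; rewrite opA in Z1.
have le1 := geomean_frame_le N0 bnd Vu Zh Zs Z0 Z1
  (x' := rowB (be d)) (y' := rowA a).
have {}le1 : loewner (V *m Z o *m V ^t*)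
    (dgC (\row_u wgeo (rowB (be d) 0 u) (rowA a 0 u) t)).
  apply: le1 => u; rewrite ?[rowA _ _ _]rowE ?[rowB _ _ _]rowE //.
      exact: be_ge.
    exact: be_gt0.
have := le1 (vecc k); rewrite -VK qf_rot // VK qf_dgC_nsq lecE => /andP[_] /=.
move=> /le_trans; apply.
under eq_bigr do rewrite [(\row__ wgeo _ _ _) _ _]rowE veccE
  [rowA _ _ _]rowE [rowB _ _ _]rowE.
rewrite (sum_mxtens (fun i j => wgeo (be d 0 j) (a 0 i) t * nsq (k i j))).
have := @trace_young_le _ _ _ K t A W (fun j => be d 0 j)
  (fun j => (be d 0 j) `^ (1 - t)) Wu.
rewrite sum_be trB => h; apply: le_trans (le_trans (h _) _).
- rewrite le_eqVlt; apply/orP; left; apply/eqP.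
  by do 2 apply: eq_bigr => ? _; rewrite /wgeo -/a [_ * (a 0 _ `^ t)]mulrC.
- move=> l j; apply: young_le => //; last exact/ltW/be_gt0.
  exact/real_spectrum_ge0/inner_psd.
- rewrite mulrDr addrA lerD2l /d [m%:R * _]mulrC divfK ?gt_eqF //.
  by rewrite ler_piMl ?(ltW e0) // lerBlDr lerDl ltW.
Qed.

(** The border bounds [c] below by the sum of [a_i^2 |k_ij|^2 / (a_i^(2-t) (b_j + d)^(t-1))], whose
    terms are [a_i^t (b_j + d)^(1-t) |k_ij|^2]. *)
Lemma epigraph_sound_pos c : 1 <= t <= 2 -> bounds_geomean s o (t - 1) ->
  Z 0%N = A *t 1%:M -> Z 1%N = 1%:M *t B ->
  psdmx (border c (Z 0%N *m vecc K) (Z o)) ->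
  t * Upsilon K t A + (1 - t) * complex.Re (\tr B) <= c.
Proof.
move=> /andP[t1 t2] bnd Z0 Z1 Bp; apply/ler_addgt0Pr => e e0.
pose d := e / m%:R; have mR : 0 < (m%:R : R) by rewrite ltr0n.
have d0 : 0 < d by rewrite divr_gt0.
rewrite opA in Z0; rewrite opB in Z1.
have le1 := geomean_frame_le N0 bnd Vu Zh Zs Z0 Z1
  (x' := rowA a) (y' := rowB (be d)).
have {}le1 : loewner (V *m Z o *m V ^t*)
    (dgC (\row_u wgeo (rowA a 0 u) (rowB (be d) 0 u) (t - 1))).
  apply: le1 => u; rewrite ?[rowA _ _ _]rowE ?[rowB _ _ _]rowE //.
      exact: be_ge.
    exact: be_gt0.
have := border_lower (border_rot V Bp) le1.
have w0 u : 0 < (\row_u wgeo (rowA a 0 u) (rowB (be d) 0 u) (t - 1)) 0 u.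
  rewrite rowE [rowA _ _ _]rowE [rowB _ _ _]rowE wgeo_gt0 //; exact: be_gt0.
rewrite Z0 VDK => /(_ w0) h1.
have := @trace_young_ge _ _ _ K t A W (fun j => be d 0 j)
  (fun j => (be d 0 j) `^ (1 - t)) Wu.
rewrite sum_be trB => h.
(* The shift costs [(t - 1) e], at most [e] since [t <= 2]. *)
apply: le_trans (_ : c + (t - 1) * (m%:R * d) <= _); last first.
  rewrite lerD2l [m%:R * _]mulrC divfK ?gt_eqF //.
  by rewrite ler_piMl ?(ltW e0) // lerBlDr.
rewrite -lerBlDr -mulNr opprB -addrA -mulrDr.
apply: le_trans (h _) _; last apply: le_trans h1.
  move=> l j; apply: young_ge_pos => //; last exact: be_gt0.
  exact/real_spectrum_ge0/inner_psd.
rewrite -(sum_mxtens (fun i j =>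
  a 0 i `^ t * be d 0 j `^ (1 - t) * nsq (k i j))).
apply: ler_sum => u _; rewrite dgC_mul veccE nsqZ.
rewrite [(\row__ wgeo _ _ _) _ _]rowE ![rowA _ _ _]rowE [rowB _ _ _]rowE.
set i := (mxtens_unindex u).1; set j := (mxtens_unindex u).2.
rewrite le_eqVlt; apply/orP; left; apply/eqP.
rewrite [RHS]mulrAC; congr (_ * _).
rewrite /wgeo invfM mulrA -!powRN; congr (_ * _ `^ _); last by ring.
rewrite -(powR_mulrn 2 (ltW (a0 i))) -powRD ?(gt_eqF (a0 i)) ?implybT //.
by congr (_ `^ _); ring.
Qed.

(** Now [b_j^2 / (b_j^(1+t) a_i^(-t)) = a_i^t b_j^(1-t)] where [b_j > 0]. Invertibility gives the
    positive eigenvalues required by Young's inequality for [t < 0]. *)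
Lemma epigraph_sound_neg c : t < 0 -> inner K t A \in unitmx ->
  bounds_geomean s o (- t) -> Z 0%N = 1%:M *t B -> Z 1%N = A *t 1%:M ->
  psdmx (border c (Z 0%N *m vecc K) (Z o)) ->
  t * Upsilon K t A + (1 - t) * complex.Re (\tr B) <= c.
Proof.
move=> t0 Yu bnd Z0 Z1 Bp.
rewrite opB in Z0; rewrite opA in Z1.
(* The test vector of [border_lower] vanishes where b does, so any positive
   upper bound will do there. *)
pose b' : 'rV[R]_m := \row_j (if b 0 j == 0 then 1 else b 0 j).
have b'0 j : 0 < b' 0 j.
  by rewrite [b' _ _]rowE; case: eqP => // /eqP bj; rewrite lt0r bj b0.
have bb' j : b 0 j <= b' 0 j.
  by rewrite [b' _ _]rowE; case: eqP => // ->; rewrite ler01.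
have le1 := geomean_frame_le N0 bnd Vu Zh Zs Z0 Z1
  (x' := rowB b') (y' := rowA a).
have {}le1 : loewner (V *m Z o *m V ^t*)
    (dgC (\row_u wgeo (rowB b' 0 u) (rowA a 0 u) (- t))).
  by apply: le1 => u; rewrite ?[rowA _ _ _]rowE ?[rowB _ _ _]rowE.
have := border_lower (border_rot V Bp) le1.
rewrite Z0 VDK => h1; apply: le_trans (h1 _); last first.
  move=> u; rewrite [(\row__ wgeo _ _ _) _ _]rowE.
  by rewrite [rowA _ _ _]rowE [rowB _ _ _]rowE wgeo_gt0.
rewrite trB.
apply: le_trans (trace_young_ge (h := fun j => b 0 j `^ (1 - t)) Wu _) _.
  move=> l j; apply: young_ge_neg => //.
  exact: real_spectrum_unit_gt0 (inner_psd _ _ _) Yu.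
rewrite -(sum_mxtens (fun i j => a 0 i `^ t * b 0 j `^ (1 - t) * nsq (k i j))).
apply: ler_sum => u _; rewrite dgC_mul veccE nsqZ.
rewrite [(\row__ wgeo _ _ _) _ _]rowE [rowA _ _ _]rowE ![rowB _ _ _]rowE.
set i := (mxtens_unindex u).1; set j := (mxtens_unindex u).2.
rewrite le_eqVlt; apply/orP; left; apply/eqP.
rewrite [RHS]mulrAC; congr (_ * _).
have s0 : 1 - t != 0 by rewrite gt_eqF // subr_gt0 (lt_trans t0).
rewrite [b' 0 j]rowE; case: eqP => [->|/eqP bj].
  by rewrite powR0 // mulr0 expr0n mul0r.
rewrite /wgeo opprK invfM -!powRN opprK mulrA [LHS]mulrC; congr (_ * _).
rewrite -(powR_mulrn 2 (b0 j)) -powRD ?bj ?implybT //.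
by congr (_ `^ _); ring.
Qed.

End Soundness.

(** * Completeness: optimal auxiliary matrices *)

Section Completeness.
Variables (R : realType) (n m : nat) (K : 'M[R[i]]_(n, m)) (t : R).
Local Notation C := R[i].
Hypothesis tN0 : t != 0.
Variable A : 'M[C]_n.
Hypothesis Apd : pdmx A.
Variables (s : seq constraint) (o : nat).

Let Y := inner K t A.
Let a := real_spectrum A.
Let y := real_spectrum Y.
(** The complex conjugate of the eigenframe of [Y], so that [B] below is the transpose of [Y^(1/t)],
    the equality case of Young's inequality. *)
Let W : 'M[C]_m := ((spectralmx Y) ^t*)^T.
Let b : 'rV[R]_m := \row_j y 0 j `^ t^-1.
Let B := W ^t* *m dgC b *m W.
Let V := spectralmx A *t W.
Let rowA (f : 'rV[R]_n) : 'rV[R]_(n * m) := \row_u f 0 (mxtens_unindex u).1.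
Let rowB (f : 'rV[R]_m) : 'rV[R]_(n * m) := \row_u f 0 (mxtens_unindex u).2.
Let k := coords K A W.

Let Wu : W \is unitarymx.
Proof. by rewrite trmx_unitary trmxC_unitary spectral_unitarymx. Qed.

Let a0 i : 0 < a 0 i. Proof. exact: real_spectrum_gt0. Qed.
Let y0 j : 0 <= y 0 j. Proof. exact/real_spectrum_ge0/inner_psd. Qed.
Let b0 j : 0 <= b 0 j. Proof. by rewrite rowE powR_ge0. Qed.

Let opA : A *t (1%:M : 'M[C]_m) = V ^t* *m dgC (rowA a) *m V.
Proof. by rewrite {1}(spectral_decomposition Apd.1) (tens_frame_l _ _ Wu). Qed.

Let opB : (1%:M : 'M[C]_n) *t B = V ^t* *m dgC (rowB b) *m V.
Proof. by rewrite (tens_frame_r _ _ (spectral_unitarymx A)). Qed.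

Let VK : V *m vecc K = vecc k.
Proof. exact: tens_vecc. Qed.

(** For this [W] the unitary matrix in [coords_inner] is the identity, so column [j] of [k] sees
    only the eigenvalue [y_j]. *)
Let k_sum j : \sum_i a 0 i `^ t * nsq (k i j) = y 0 j.
Proof.
rewrite coords_inner trmxK.
have [-> _] := unitary_adjK (spectral_unitarymx Y).
rewrite (bigD1 j) //= big1 => [|l lj]; rewrite [1%:M _ _]mxE.
  by rewrite eqxx /nsq /= expr1n expr0n /= !addr0 mulr1.
by rewrite (negbTE lj) /nsq /= expr0n addr0 mulr0.
Qed.

Let k_eq0 i j : y 0 j = 0 -> nsq (k i j) = 0.
Proof.
move=> yj; have /eqP := k_sum j; rewrite yj psumr_eq0.
  move=> /allP/(_ i (mem_index_enum _))/eqP/eqP; rewrite mulf_eq0.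
  by rewrite powR_eq0 (gt_eqF (a0 i)) => /eqP.
by move=> l _; rewrite mulr_ge0 ?powR_ge0 ?nsq_ge0.
Qed.

Let UpsilonE : Upsilon K t A = \sum_j b 0 j.
Proof. by rewrite Upsilon_sum; apply: eq_bigr => j _; rewrite [b _ _]rowE. Qed.

Let trB : complex.Re (\tr B) = Upsilon K t A.
Proof. by rewrite tr_cong_dgC // UpsilonE. Qed.

Let Bh : B \is hermsymmx. Proof. exact/herm_cong/dgC_herm. Qed.

Let Bpsd : psdmx ((1%:M : 'M[C]_n) *t B).
Proof. by rewrite opB; apply/psd_cong/psd_dgC => u; rewrite rowE. Qed.

Let k_wsum : (t < 0 -> Y \in unitmx) ->
  \sum_i \sum_j a 0 i `^ t * b 0 j `^ (1 - t) * nsq (k i j) = Upsilon K t A.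
Proof.
move=> Yu; rewrite exchange_big UpsilonE /=; apply: eq_bigr => j _.
transitivity (b 0 j `^ (1 - t) * \sum_i a 0 i `^ t * nsq (k i j)).
  by rewrite mulr_sumr; apply: eq_bigr => i _; ring.
rewrite k_sum [b 0 j]rowE mulrC young_eq // => t0.
exact: real_spectrum_unit_gt0 (inner_psd _ _ _) (Yu t0).
Qed.

Lemma hypograph_complete : 0 < t -> attains_geomean s o t ->
  exists B Z, [/\ B \is hermsymmx, psdmx ((1%:M : 'M[C]_n) *t B),
    (forall k, Z k \is hermsymmx) /\ sys_holds Z s,
    Z 0%N = 1%:M *t B /\ Z 1%N = A *t 1%:M &
    t * Upsilon K t A + (1 - t) * complex.Re (\tr B) =
      complex.Re (qf (Z o) (vecc K))].
Proof.
move=> t0 att.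
have rA u : 0 <= rowA a 0 u by rewrite rowE ltW.
have rB u : 0 <= rowB b 0 u by rewrite rowE.
have [Z [Zh Zs Z0 Z1 Zo]] := geomean_frame_attained V att rB rA.
exists B, Z; split; [exact: Bh | exact: Bpsd | exact: (conj Zh Zs) |
  by rewrite opA opB; exact: (conj Z0 Z1) |].
(* Since [tr B = Upsilon K t A], the left-hand side collapses to [Upsilon K t A]. *)
rewrite trB -mulrDl addrC subrK mul1r Zo qf_cong VK qf_dgC_nsq /= -k_wsum.
  rewrite -(sum_mxtens (fun i j =>
    a 0 i `^ t * b 0 j `^ (1 - t) * nsq (k i j))).
  apply: eq_bigr => u _; rewrite rowE veccE [rowA _ _ _]rowE [rowB _ _ _]rowE.
  by rewrite /wgeo [_ * (a 0 _ `^ t)]mulrC.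
by rewrite ltNge ltW.
Qed.

Let border_frame c u T :
  psdmx (border c u T) -> psdmx (border c (V ^t* *m u) (V ^t* *m T *m V)).
Proof. by move=> /(border_rot (V ^t*)); rewrite trmxCK. Qed.

(** In the frame [V] everything inside the border is diagonal. The balance [x^2 = a^t b^(1-t) g] is
    asked only where [k] is nonzero, as it may fail where [b] vanishes. *)
Let border_psd (x : 'rV[R]_(n * m)) (g : 'rV[R]_(n * m)) :
    (t < 0 -> Y \in unitmx) ->
    (forall u, 0 <= g 0 u) ->
    (forall u (i := (mxtens_unindex u).1) (j := (mxtens_unindex u).2),
      nsq (k i j) != 0 ->
      x 0 u ^+ 2 = a 0 i `^ t * b 0 j `^ (1 - t) * g 0 u) ->
  psdmx (border (t * Upsilon K t A + (1 - t) * complex.Re (\tr B))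
    (V ^t* *m dgC x *m V *m vecc K) (V ^t* *m dgC g *m V)).
Proof.
move=> Yu g0 xg; rewrite trB -mulrDl addrC subrK mul1r -k_wsum //.
rewrite -!mulmxA VK !mulmxA -(mulmxA _ _ (vecc k)); apply: border_frame.
rewrite -(sum_mxtens (fun i j => a 0 i `^ t * b 0 j `^ (1 - t) * nsq (k i j))).
pose cs : 'rV[R]_(n * m) := \row_u (a 0 (mxtens_unindex u).1 `^ t *
  b 0 (mxtens_unindex u).2 `^ (1 - t) *
  nsq (k (mxtens_unindex u).1 (mxtens_unindex u).2)).
rewrite (eq_bigr (cs 0)) => [|u _]; last by rewrite [cs _ _]rowE.
apply: (@psd_border_dgC _ _ cs) => // u; rewrite [cs _ _]rowE.
  by rewrite !mulr_ge0 ?powR_ge0 ?nsq_ge0.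
rewrite dgC_mul nsqZ veccE.
have [->|kN0] := eqVneq (nsq (k (mxtens_unindex u).1 (mxtens_unindex u).2)) 0.
  by rewrite !mulr0 mul0r.
by rewrite xg // mulrAC.
Qed.

Lemma epigraph_complete_pos : 1 <= t -> attains_geomean s o (t - 1) ->
  exists B Z, [/\ B \is hermsymmx, psdmx ((1%:M : 'M[C]_n) *t B),
    (forall k, Z k \is hermsymmx) /\ sys_holds Z s,
    Z 0%N = A *t 1%:M /\ Z 1%N = 1%:M *t B &
    psdmx (border (t * Upsilon K t A + (1 - t) * complex.Re (\tr B))
      (Z 0%N *m vecc K) (Z o))].
Proof.
move=> t1 att; have t0 : 0 < t by apply: lt_le_trans t1.
have rA u : 0 <= rowA a 0 u by rewrite rowE ltW.
have rB u : 0 <= rowB b 0 u by rewrite rowE.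
have [Z [Zh Zs Z0 Z1 Zo]] := geomean_frame_attained V att rA rB.
exists B, Z; split; [exact: Bh | exact: Bpsd | exact: (conj Zh Zs) |
  by rewrite opA opB; exact: (conj Z0 Z1) |].
rewrite Z0 Zo; apply: border_psd => [|u|u i j kN0].
- by rewrite ltNge ltW.
- by rewrite rowE wgeo_ge0.
(* A nonzero coordinate of [K] forces [b_j] to be nonzero, so that [b_j^(1-t)] and [b_j^(t-1)]
   cancel. *)
have yN0 : y 0 j != 0 by apply: contra_neq kN0 => /k_eq0 ->.
have bj : b 0 j != 0 by rewrite [b 0 j]rowE powR_eq0 (negbTE yN0).
rewrite [(\row__ wgeo _ _ _) _ _]rowE [rowA _ _ _]rowE [rowB _ _ _]rowE -/i -/j.
rewrite /wgeo mulrACA -!powRD ?(gt_eqF (a0 i)) ?bj ?implybT //.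
have -> : 1 - t + (t - 1) = 0 by ring.
have -> : t + (1 - (t - 1)) = 2 by ring.
by rewrite powRr0 mulr1 (powR_mulrn 2 (ltW (a0 i))).
Qed.

Lemma epigraph_complete_neg : t < 0 -> Y \in unitmx ->
  attains_geomean s o (- t) ->
  exists B Z, [/\ B \is hermsymmx, psdmx ((1%:M : 'M[C]_n) *t B),
    (forall k, Z k \is hermsymmx) /\ sys_holds Z s,
    Z 0%N = 1%:M *t B /\ Z 1%N = A *t 1%:M &
    psdmx (border (t * Upsilon K t A + (1 - t) * complex.Re (\tr B))
      (Z 0%N *m vecc K) (Z o))].
Proof.
move=> t0 Yu att.
have rA u : 0 <= rowA a 0 u by rewrite rowE ltW.
have rB u : 0 <= rowB b 0 u by rewrite rowE.
have [Z [Zh Zs Z0 Z1 Zo]] := geomean_frame_attained V att rB rA.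
exists B, Z; split; [exact: Bh | exact: Bpsd | exact: (conj Zh Zs) |
  by rewrite opA opB; exact: (conj Z0 Z1) |].
rewrite Z0 Zo; apply: border_psd => [//|u|u i j _].
  by rewrite rowE wgeo_ge0.
have yN0 : y 0 j != 0.
  by rewrite gt_eqF // (real_spectrum_unit_gt0 _ (inner_psd _ _ _) Yu).
have bj : b 0 j != 0 by rewrite [b 0 j]rowE powR_eq0 (negbTE yN0).
rewrite [(\row__ wgeo _ _ _) _ _]rowE [rowA _ _ _]rowE [rowB _ _ _]rowE -/i -/j.
rewrite /wgeo [_ * a 0 i `^ (- t)]mulrC mulrACA.
rewrite -!powRD ?(gt_eqF (a0 i)) ?bj ?implybT //.
have -> : t - t = 0 by ring.
have -> : 1 - t + (1 - - t) = 2 by ring.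
by rewrite powRr0 mul1r (powR_mulrn 2 (b0 j)).
Qed.

End Completeness.

(** * Real-affine matrix maps and LMIs *)

Section LmiEncoding.
Variable R : realType.
Local Notation C := R[i].

Section Affine.
Variable I : finType.
Implicit Types (f g : (I -> R) -> C).

(** Complex coefficients with real variables: the class is stable under conjugation as well as under
    complex linear combinations. *)
Definition affine f :=
  exists (c : C) (d : I -> C), forall x, f x = c + \sum_k (x k)%:C * d k.

Lemma affine_ext f g : f =1 g -> affine f -> affine g.
Proof. by move=> fg [c [d fE]]; exists c, d => x; rewrite -fg. Qed.

Lemma affine_cst c : affine (fun=> c).
Proof.
by exists c, (fun=> 0) => x; rewrite big1 ?addr0 // => k _; rewrite mulr0.
Qed.

Lemma affine_var k : affine (fun x => (x k)%:C).
Proof.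
exists 0, (fun l => (l == k)%:R) => x; rewrite add0r (bigD1 k) //= eqxx mulr1.
by rewrite big1 ?addr0 // => l /negbTE->; rewrite mulr0.
Qed.

Lemma affineD f g : affine f -> affine g -> affine (fun x => f x + g x).
Proof.
move=> [c [d fE]] [c' [d' gE]]; exists (c + c'), (fun k => d k + d' k) => x.
rewrite fE gE addrACA -big_split /=; congr (_ + _).
by apply: eq_bigr => k _; rewrite mulrDr.
Qed.

Lemma affineM c f : affine f -> affine (fun x => c * f x).
Proof.
move=> [c' [d fE]]; exists (c * c'), (fun k => c * d k) => x.
rewrite fE mulrDr mulr_sumr; congr (_ + _).
by apply: eq_bigr => k _; rewrite mulrCA.
Qed.

Lemma affineN f : affine f -> affine (fun x => - f x).
Proof.
by move=> /(affineM (-1)); apply: affine_ext => x; rewrite mulN1r.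
Qed.

Lemma affine_conj f : affine f -> affine (fun x => Num.conj (f x)).
Proof.
move=> [c [d fE]]; exists (Num.conj c), (fun k => Num.conj (d k)) => x.
rewrite fE rmorphD rmorph_sum /=; congr (_ + _).
by apply: eq_bigr => k _; rewrite rmorphM /= conj_rc.
Qed.

Lemma affine_sum (J : finType) (F : J -> (I -> R) -> C) :
  (forall j, affine (F j)) -> affine (fun x => \sum_j F j x).
Proof.
move=> /fin_all_exists[c /fin_all_exists[d FE]].
exists (\sum_j c j), (fun k => \sum_j d j k) => x.
under eq_bigr do rewrite FE.
rewrite big_split exchange_big /=; congr (_ + _).
by apply: eq_bigr => k _; rewrite mulr_sumr.
Qed.

Definition affine_mx a b (F : (I -> R) -> 'M[C]_(a, b)) :=
  forall i j, affine (fun x => F x i j).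

Lemma affine_mx_cst a b (M : 'M[C]_(a, b)) : affine_mx (fun=> M).
Proof. by move=> i j; apply: affine_cst. Qed.

Lemma affine_mx_adj a b (F : (I -> R) -> 'M[C]_(a, b)) :
  affine_mx F -> affine_mx (fun x => (F x) ^t*).
Proof.
by move=> Fa i j; apply: affine_ext (affine_conj (Fa j i)) => x; rewrite adjE.
Qed.

Lemma affine_mx_mulr a b c (F : (I -> R) -> 'M[C]_(a, b)) (M : 'M[C]_(b, c)) :
  affine_mx F -> affine_mx (fun x => F x *m M).
Proof.
move=> Fa i j.
apply: affine_ext (affine_sum (fun k => affineM (M k j) (Fa i k))).
by move=> x; rewrite mxE; apply: eq_bigr => k _; rewrite mulrC.
Qed.

Lemma affine_mx_mull a b c (F : (I -> R) -> 'M[C]_(a, b)) (M : 'M[C]_(c, a)) :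
  affine_mx F -> affine_mx (fun x => M *m F x).
Proof.
move=> Fa i j.
apply: affine_ext (affine_sum (fun k => affineM (M i k) (Fa k j))).
by move=> x; rewrite mxE.
Qed.

Lemma affine_mx_block a b a' b' (F : (I -> R) -> 'M[C]_(a, b))
    (G : (I -> R) -> 'M[C]_(a, b')) (H : (I -> R) -> 'M[C]_(a', b))
    (L : (I -> R) -> 'M[C]_(a', b')) :
  affine_mx F -> affine_mx G -> affine_mx H -> affine_mx L ->
  affine_mx (fun x => block_mx (F x) (G x) (H x) (L x)).
Proof.
move=> Fa Ga Ha La u v; rewrite -[u]splitK -[v]splitK.
case: (split u) => i'; case: (split v) => j' /=.
- by apply: affine_ext (Fa i' j') => x; rewrite block_mxEul.
- by apply: affine_ext (Ga i' j') => x; rewrite block_mxEur.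
- by apply: affine_ext (Ha i' j') => x; rewrite block_mxEdl.
- by apply: affine_ext (La i' j') => x; rewrite block_mxEdr.
Qed.

Lemma affine_mx_tensl a b a' b' (F : (I -> R) -> 'M[C]_(a, b))
    (M : 'M[C]_(a', b')) : affine_mx F -> affine_mx (fun x => F x *t M).
Proof.
move=> Fa i j; apply: affine_ext (affineM _ (Fa _ _)) => x.
by rewrite mxE mulrC.
Qed.

Lemma affine_mx_tensr a b a' b' (F : (I -> R) -> 'M[C]_(a, b))
    (M : 'M[C]_(a', b')) : affine_mx F -> affine_mx (fun x => M *t F x).
Proof.
by move=> Fa i j; apply: affine_ext (affineM _ (Fa _ _)) => x; rewrite mxE.
Qed.

Lemma affine_mx_scalar n f : affine f -> affine_mx (fun x => (f x)%:M : 'M_n).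
Proof.
move=> fa i j; have [->|ij] := eqVneq i j.
  by apply: affine_ext fa => x; rewrite mxE eqxx.
apply: affine_ext (affine_cst 0) => x; by rewrite mxE (negbTE ij).
Qed.

Definition representable N (phi : (I -> R) -> Prop) :=
  exists L : lmi R I N, forall x, lmi_holds L x <-> phi x.

(** Evaluating at 0 and at the unit vectors shows that the coefficients of a Hermitian-valued affine
    map are Hermitian. *)
Lemma representable_psd N (F : (I -> R) -> 'M[C]_N) :
    affine_mx F -> (forall x, F x \is hermsymmx) ->
  representable N (fun x => psdmx (F x)).
Proof.
move=> Fa Fh.
have /fin_all_exists[c /fin_all_exists[d FE]] :
    forall ij : 'I_N * 'I_N, exists c d, forall x,
      F x ij.1 ij.2 = c + \sum_k (x k)%:C * d k by move=> [i j]; apply: Fa.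
pose A0 : 'M[C]_N := \matrix_(i, j) c (i, j).
pose A1 k : 'M[C]_N := \matrix_(i, j) d (i, j) k.
have FA x : F x = A0 + \sum_k (x k)%:C *: A1 k.
  apply/matrixP => i j; rewrite mxE summxE (FE (i, j)) mxE; congr (_ + _).
  by apply: eq_bigr => k _; rewrite !mxE.
have A0h : A0 \is hermsymmx.
  have := Fh (fun=> 0); rewrite FA big1 ?addr0 // => k _.
  by rewrite rmorph0 scale0r.
have A1h k : A1 k \is hermsymmx.
  pose x l : R := (l == k)%:R; have xk : (x k)%:C = 1 by rewrite /x eqxx.
  have x0 l : l != k -> (x l)%:C = 0 by rewrite /x => /negbTE->.
  have := Fh x; rewrite FA (bigD1 k isT) xk scale1r.
  rewrite big1 => [|l lk]; last by rewrite x0 // scale0r.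
  move=> /= /hermP; rewrite addr0 adjD; move/hermP: A0h => -> /addrI E.
  exact/hermP.
by exists (Lmi A0h A1h) => x; rewrite FA.
Qed.

Lemma psd_pad a b (A : 'M[C]_a) :
  psdmx (block_mx A 0 0 (0 : 'M[C]_b)) <-> psdmx A.
Proof.
split=> /psdmxP[Ah Ap]; apply/psdmxP; split.
- apply/hermP/matrixP => i j.
  move/hermP/matrixP/(_ (lshift b i) (lshift b j)): Ah.
  by rewrite !adjE !block_mxEul.
- move=> v; have := Ap (col_mx v 0).
  by rewrite /qf sesq_block !sesq0m !addr0.
- apply/hermP; rewrite tr_block_mx map_block_mx !trmx0 !map_mx0.
  by move/hermP: Ah => ->.
- by move=> v; rewrite -[v]vsubmxK /qf sesq_block !sesq0m !addr0; exact: Ap.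
Qed.

(** A zero block enlarges an LMI without changing its meaning; the bordered LMI of size [1 + n m]
    reaches size [2 m n] in this way. *)
Lemma representable_pad N N' (F : (I -> R) -> 'M[C]_N) : (N <= N')%N ->
    affine_mx F -> (forall x, F x \is hermsymmx) ->
  representable N' (fun x => psdmx (F x)).
Proof.
move=> /subnKC <- Fa Fh; set d := (N' - N)%N.
have [|x|L LE] :=
  @representable_psd _ (fun x => block_mx (F x) 0 0 (0 : 'M[C]_d)).
- by apply: affine_mx_block => //; apply: affine_mx_cst.
- have /hermP z : (0 : 'M[C]_d) ^t* = 0 by rewrite trmx0 map_mx0.
  by have := herm_block (0 : 'M[C]_(N, d)) (Fh x) z; rewrite trmx0 map_mx0.
- by exists L => x; rewrite LE psd_pad.
Qed.

Lemma psd11 (r : R) : psdmx ((r%:C)%:M : 'M[C]_1) <-> 0 <= r.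
Proof.
have -> : (r%:C)%:M = dgC (const_mx r) :> 'M[C]_1.
  by apply/matrixP => i j; rewrite !mxE.
split=> [/psdmxP[_ /(_ (const_mx 1))]|r0].
  rewrite qf_dgC_nsq ler0c big_ord1 !mxE /nsq /= expr1n expr0n /= addr0.
  by rewrite mulr1.
by apply: psd_dgC => i; rewrite mxE.
Qed.

Lemma representable_le (f : (I -> R) -> R) : affine (fun x => (f x)%:C) ->
  representable 1 (fun x => 0 <= f x).
Proof.
move=> fa; have [|x|L LE] := @representable_psd 1 (fun x => ((f x)%:C)%:M).
- exact: affine_mx_scalar.
- by apply/hermP; rewrite tr_scalar_mx map_scalar_mx /= conj_rc.
- by exists L => x; rewrite LE psd11.
Qed.

Lemma representable_True N : representable N (fun=> True).
Proof.
have [L LE] := @representable_pad 0 N (fun=> 0) (leq0n _) (affine_mx_cst 0)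
  (fun=> ltac:(by apply/hermP; rewrite trmx0 map_mx0)).
exists L => x; rewrite LE; split=> // _; apply/psdmxP; split.
  by apply/hermP; rewrite trmx0 map_mx0.
by move=> v; rewrite /qf sesq0m.
Qed.

(** Inverse of [herm_coord]: for [j < i] the pair [(i, j)] carries the imaginary part of the entry
    below the diagonal, whence the minus sign above it. *)
Definition hermmx n (x : 'I_n * 'I_n -> R) : 'M[C]_n :=
  \matrix_(i, j) if (i < j)%N then (x (i, j))%:C - 'i * (x (j, i))%:C
    else if (j < i)%N then (x (j, i))%:C + 'i * (x (i, j))%:C
    else (x (i, j))%:C.

Lemma hermmx_herm n x : @hermmx n x \is hermsymmx.
Proof.
apply/hermP/matrixP => i j; rewrite adjE !mxE.
have cI : Num.conj ('i : C) = - 'i by exact: conjCi.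
by case: ltngtP => [ij|ij|/val_inj->];
  rewrite ?rmorphD ?rmorphN ?rmorphM /= ?conj_rc ?cI ?mulNr ?opprK.
Qed.

Lemma hermmx_coordK n (H : 'M[C]_n) tau : H \is hermsymmx ->
  hermmx (fun ij => herm_coord (H, tau) (Some ij)) = H.
Proof.
move=> Hh; apply/matrixP => i j; rewrite mxE /=.
have [HR HI] : complex.Re (H j i) = complex.Re (H i j) /\
    complex.Im (H j i) = - complex.Im (H i j).
  by rewrite -(hermE i j Hh); case: (H i j).
case: ltngtP => [ij|ij|/val_inj ij].
- by rewrite HI rmorphN mulrN opprK -complexE.
- by rewrite HR -complexE.
- by apply: herm_real; rewrite ij; exact: hermE.
Qed.

Lemma affine_hermmx n (sel : 'I_n * 'I_n -> I) :
  affine_mx (fun x : I -> R => hermmx (fun ij => x (sel ij))).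
Proof.
move=> i j; apply: affine_ext (fun x => esym (mxE _ _ _ _)) _.
case: ltngtP => _; last exact: affine_var.
  apply: affineD (affine_var _) (affineN (affineM _ (affine_var _))).
exact: affineD (affine_var _) (affineM _ (affine_var _)).
Qed.

End Affine.

(** * From lists of LMIs to SDP representations *)

Section Representations.
Variables (n : nat) (J : finType).
Implicit Types (z : option ('I_n * 'I_n) + J -> R).

Lemma lmi_reindex (I I' : finType) N (f : I -> I') (g : I' -> I)
    (phi : (I -> R) -> Prop) : cancel f g -> cancel g f ->
  representable N phi -> representable N (fun x => phi (x \o f)).
Proof.
move=> fK gK [L LE].
exists (Lmi (lmi_const_herm L) (fun k => lmi_coef_herm L (g k))) => x.
rewrite -LE /lmi_holds /= (reindex f) /=; last first.
  by exists g => k _; rewrite ?fK ?gK.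
by under [X in psdmx (_ + X)]eq_bigr do rewrite fK.
Qed.

(** The auxiliary variables may be indexed by any finite type [J]; numbering them by [enum_rank]
    gives the required ordinals. *)
Lemma sdp_representationI (S : 'M[C]_n * R -> Prop) (k N N1 : nat)
    (phi : nat -> (option ('I_n * 'I_n) + J -> R) -> Prop) psi chi :
    (forall j, representable N (phi j)) ->
    representable N1 psi -> representable 1 chi ->
    (forall x, S x <-> (pdmx x.1 /\ exists y : J -> R,
      let z := join_vars (herm_coord x) y in
      [/\ forall j, (j < k)%N -> phi j z, psi z & chi z])) ->
  sdp_representation S (nseq k N ++ [:: N1; 1%N]).
Proof.
move=> phiR psiR chiR SE; pose ns := nseq k N ++ [:: N1; 1%N].
pose f (u : option ('I_n * 'I_n) + J) : option ('I_n * 'I_n) + 'I_#|J| :=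
  match u with inl v => inl v | inr j => inr (enum_rank j) end.
pose g (u : option ('I_n * 'I_n) + 'I_#|J|) : option ('I_n * 'I_n) + J :=
  match u with inl v => inl v | inr j => inr (enum_val j) end.
have fK : cancel f g by case=> //= j; rewrite enum_rankK.
have gK : cancel g f by case=> //= j; rewrite enum_valK.
pose theta (i : nat) (z : option ('I_n * 'I_n) + J -> R) :=
  if (i < k)%N then phi i z else if i == k then psi z else chi z.
have szns : size ns = k.+2 by rewrite size_cat size_nseq addn2.
have /fin_all_exists[L LE] (i : 'I_(size ns)) :
    representable (nth 0%N ns i)
      (fun w : option ('I_n * 'I_n) + 'I_#|J| -> R => theta i (w \o f)).
  apply: (lmi_reindex fK gK); rewrite /theta nth_cat size_nseq nth_nseq.
  case: ltnP => // ki; case: eqP => [->|ik]; first by rewrite subnn.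
  have -> : nat_of_ord i = k.+1.
    apply/eqP; rewrite eqn_leq -ltnS -szns ltn_ord ltn_neqAle ki eq_sym andbT.
    exact/eqP.
  by rewrite subSnn.
exists #|J|, L => x; rewrite SE; split=> -[xp [y hy]]; split=> //.
- exists (fun j => y (enum_val j)) => i; rewrite LE.
  have -> : join_vars (herm_coord x) (fun j => y (enum_val j)) \o f =
      join_vars (herm_coord x) y.
    by apply: boolp.funext => -[//|j] /=; rewrite enum_rankK.
  case: hy => h1 h2 h3; rewrite /theta.
  by case: ltnP => [/h1//|_]; case: eqP.
- exists (y \o enum_rank).
  have zE : join_vars (herm_coord x) (y \o enum_rank) =
      join_vars (herm_coord x) y \o f.
    by apply: boolp.funext => -[].
  have hz i : (i < k.+2)%N ->
      theta i (join_vars (herm_coord x) (y \o enum_rank)).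
    by rewrite -szns zE => ins; have := hy (Ordinal ins); rewrite LE.
  split=> [j jk||].
  + by have := hz j; rewrite /theta jk; apply; rewrite ltnS leqW // ltnW.
  + by have := hz k; rewrite /theta ltnn eqxx; apply; rewrite ltnS leqnSn.
  + by have := hz k.+1 (leqnn _); rewrite /theta ltnNge leqnSn /= gtn_eqF.
Qed.

End Representations.
End LmiEncoding.

(** * Encoding the whole system of constraints *)

Section Assembly.
Variables (R : realType) (n m : nat) (K : 'M[R[i]]_(n, m)).
Local Notation C := R[i].
Variables (s : seq constraint) (o : nat).
(* [swap] exchanges the roles of [A (x) 1] and [1 (x) B] at the nodes 0 and 1,
   [ext] adds the bordered LMI with corner c, and (al, be, ga, de) are the
   coefficients of the scalar inequality. *)
Variables (swap ext : bool) (al be ga de : R).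

Definition op0 (A : 'M[C]_n) (B : 'M[C]_m) : 'M[C]_(n * m) :=
  if swap then A *t 1%:M else 1%:M *t B.
Definition op1 (A : 'M[C]_n) (B : 'M[C]_m) : 'M[C]_(n * m) :=
  if swap then 1%:M *t B else A *t 1%:M.

Definition feasible (A : 'M[C]_n) (tau : R) (B : 'M[C]_m) (c : R)
    (Z : nat -> 'M[C]_(n * m)) : Prop :=
  [/\ B \is hermsymmx /\ psdmx ((1%:M : 'M[C]_n) *t B),
    (forall k, Z k \is hermsymmx) /\ sys_holds Z s,
    Z 0%N = op0 A B /\ Z 1%N = op1 A B,
    ext -> psdmx (border c (Z 0%N *m vecc K) (Z o)) &
    0 <= al * complex.Re (qf (Z o) (vecc K)) + be * complex.Re (\tr B) +
         ga * tau + de * c].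

(** A crude bound on [o] and on all nodes of [s], so that finitely many matrix variables suffice. *)
Let top := (o + \sum_(t <- s) (t.1.1 + t.1.2 + t.2))%N.
Let N := (n * m)%N.
Let J : finType := ('I_top.+1 * ('I_N * 'I_N) + ('I_m * 'I_m + unit))%type.
Let I : finType := (option ('I_n * 'I_n) + J)%type.

Let vA (z : I -> R) : 'M[C]_n := hermmx (fun ij => z (inl (Some ij))).
Let vB (z : I -> R) : 'M[C]_m := hermmx (fun ij => z (inr (inr (inl ij)))).
Let vZ (k : nat) (z : I -> R) : 'M[C]_N :=
  hermmx (fun ij => z (inr (inl (inord k, ij)))).
Let vc (z : I -> R) : R := z (inr (inr (inr tt))).
Let vt (z : I -> R) : R := z (inl None).
(** The operators are substituted at nodes 0 and 1, so the equations for [Z 0] and [Z 1] in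
    [feasible] cost no LMI. *)
Let node (k : nat) (z : I -> R) : 'M[C]_N :=
  if k is 0%N then op0 (vA z) (vB z) else
  if k is 1%N then op1 (vA z) (vB z) else vZ k z.

Let opA_aff : affine_mx (fun z => vA z *t (1%:M : 'M[C]_m)).
Proof. by apply: affine_mx_tensl; exact: affine_hermmx. Qed.

Let opB_aff : affine_mx (fun z => (1%:M : 'M[C]_n) *t vB z).
Proof. by apply: affine_mx_tensr; exact: affine_hermmx. Qed.

Let herm1 k : (1%:M : 'M[C]_k) \is hermsymmx.
Proof. by apply/hermP; rewrite trmx1 map_mx1. Qed.

Let node_aff k : affine_mx (node k).
Proof.
by case: k => [|[|k]]; rewrite /node /op0 /op1; last exact: affine_hermmx;
  case: swap.
Qed.

Let node_herm k z : node k z \is hermsymmx.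
Proof.
case: k => [|[|k]]; rewrite /node /op0 /op1; last exact: hermmx_herm.
  by case: swap; apply: herm_tens => //; exact: hermmx_herm.
by case: swap; apply: herm_tens => //; exact: hermmx_herm.
Qed.

Lemma affine_Re (K0 : finType) (f : (K0 -> R) -> C) :
  affine f -> affine (fun x => (complex.Re (f x))%:C).
Proof.
move=> fa.
apply: affine_ext (affineM (2^-1) (affineD fa (affine_conj fa))) => x.
by rewrite ReJ_add mulrC.
Qed.

Let scalar z := al * complex.Re (qf (node o z) (vecc K)) +
  be * complex.Re (\tr (vB z)) + ga * vt z + de * vc z.

Let scalar_aff : affine (fun z => (scalar z)%:C).
Proof.
have qa : affine (fun z => qf (node o z) (vecc K)).
  by apply: affine_mx_mulr; apply: affine_mx_mull; exact: node_aff.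
have ta : affine (fun z => \tr (vB z)).
  by apply: affine_sum => j; exact: affine_hermmx.
have := affineD (affineD (affineD (affineM al%:C (affine_Re qa))
  (affineM be%:C (affine_Re ta))) (affineM ga%:C (affine_var R (inl None : I))))
  (affineM de%:C (affine_var R (inr (inr (inr tt)) : I))).
by apply: affine_ext => z; rewrite /scalar !rmorphD !rmorphM.
Qed.

Let nodes_le t : t \in s -> [/\ t.1.1 <= top, t.1.2 <= top & t.2 <= top]%N.
Proof.
move=> ts; have le1 : (t.1.1 + t.1.2 + t.2 <= top)%N.
  by rewrite /top (big_rem t) //= addnCA leq_addr.
by split; apply: leq_trans le1;
  rewrite ?leq_addl // -addnA ?leq_addr // addnCA leq_addr.
Qed.

Lemma sdp_assembly (S : 'M[C]_n * R -> Prop) : (0 < n)%N -> (0 < m)%N ->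
    (forall x, S x <-> (pdmx x.1 /\ exists B c Z, feasible x.1 x.2 B c Z)) ->
  sdp_representation S
    (nseq (size s + ext) (2 * m * n)%N ++ [:: (m * n)%N; 1%N]).
Proof.
move=> n0 m0 SE; have NE : (n * m = m * n)%N by rewrite mulnC.
have N2 : (2 * m * n = N + N)%N by rewrite -mulnA -NE mul2n addnn.
have N0 : (0 < N)%N by rewrite muln_gt0 n0.
pose T j := nth (0, 0, 0)%N s j.
(* Indices from [size s] on stand for the bordered LMI: one of them is below [size s + ext] when
   [ext] holds, none otherwise. *)
pose phi j (z : I -> R) := if (j < size s)%N then
    psdmx (block_mx (node (T j).1.1 z) (node (T j).1.2 z)
                    (node (T j).1.2 z) (node (T j).2 z))
  else psdmx (border (vc z) (node 0 z *m vecc K) (node o z)).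
rewrite N2 -NE.
apply: (@sdp_representationI _ n J S (size s + ext) (N + N) N phi
  (fun z => psdmx ((1%:M : 'M[C]_n) *t vB z)) (fun z => 0 <= scalar z)).
- move=> j; rewrite /phi; case: (j < size s)%N.
    apply: representable_pad => // [|z].
      by apply: affine_mx_block; exact: node_aff.
    by have := herm_block (node (T j).1.2 z) (node_herm (T j).1.1 z)
      (node_herm (T j).2 z); rewrite (hermP _).1.
  (* The bordered matrix has size [1 + N], at most [N + N] because [N > 0]. *)
  apply: representable_pad => // [|?|z]; first by rewrite leq_add2r.
    apply: affine_mx_block; last exact: node_aff.
    + by apply: affine_mx_scalar; exact: affine_var.
    + by apply: affine_mx_adj; apply: affine_mx_mulr; exact: node_aff.
    + by apply: affine_mx_mulr; exact: node_aff.
  exact: border_herm.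
- apply: representable_psd => // z.
  by apply: herm_tens => //; exact: hermmx_herm.
- exact: representable_le.
- move=> x; rewrite SE; split=> -[xp p]; split=> //.
    case: p => B [c [Z [[Bh Bp] [Zh Zs] [Z0 Z1] Zc Zt]]].
    pose y (j : J) : R := match j with
      | inl (k, ij) => herm_coord (Z k, 0) (Some ij)
      | inr (inl ij) => herm_coord (B, 0) (Some ij)
      | inr (inr tt) => c end.
    exists y => z.
    have zA : vA z = x.1 by exact: hermmx_coordK x.2 xp.1.
    have zB : vB z = B by exact: hermmx_coordK 0 Bh.
    (* [inord] is faithful only up to [top]. *)
    have zZ k : (k <= top)%N -> node k z = Z k.
      case: k => [|[|k]] kt; rewrite /node ?zA ?zB //.
      rewrite -[RHS](hermmx_coordK 0 (Zh _)).
      by rewrite -[in RHS](inordK (_ : k.+2 < top.+1)%N).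
    have ot : (o <= top)%N by rewrite leq_addr.
    split.
    + move=> j jk; rewrite /phi; case: ltnP => js.
        have [t1 t2 t3] := nodes_le (mem_nth (0, 0, 0)%N js).
        by rewrite !zZ //; apply: Zs; exact: mem_nth.
      rewrite !zZ //; apply: Zc; move: jk js; case: (ext) => //.
      by rewrite addn0 ltnNge => /negbTE->.
    + by rewrite zB.
    + by rewrite /scalar zZ // zB.
  case: p => y; set z := join_vars _ y => -[h1 h2 h3].
  have zA : vA z = x.1 by exact: hermmx_coordK x.2 xp.1.
  exists (vB z), (vc z), (fun k => node k z); split => //.
  + by split=> //; exact: hermmx_herm.
  + split=> // t ts; have tl : (index t s < size s)%N by rewrite index_mem.
    have := h1 (index t s); rewrite /phi tl /T nth_index //; apply.
    exact: ltn_addr.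
  + by rewrite /node zA.
  + move=> e; have := h1 (size s); rewrite /phi ltnn e; apply.
    by rewrite addn1.
Qed.

End Assembly.

(** * Degenerate dimensions and the three ranges of [t] *)

Lemma Upsilon_degenerate (R : realType) n m (K : 'M[R[i]]_(n, m)) t A :
  t != 0 -> (n == 0)%N || (m == 0)%N -> Upsilon K t A = 0.
Proof.
move=> tN0 nm0; rewrite Upsilon_sum big1 // => j _.
have n0 : n = 0%N.
  by case/orP: nm0 => /eqP // m0; case: j => j; rewrite m0 ltn0.
suff -> : real_spectrum (inner K t A) 0 j = 0 by rewrite powR0 ?invr_eq0.
apply: complexI; rewrite real_spectrum_qf; last exact: (inner_psd _ _ _).1.
suff -> : inner K t A = 0 by rewrite /qf sesq0m.
move: K A {nm0}; rewrite n0 => K A.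
by apply/matrixP => a b; rewrite !mxE big_ord0.
Qed.

Lemma sdp_degenerate (R : realType) n N N1 (S : 'M[R[i]]_n * R -> Prop) ga :
  (forall x, S x <-> (pdmx x.1 /\ 0 <= ga * x.2)) ->
  sdp_representation S (nseq 0 N ++ [:: N1; 1%N]).
Proof.
move=> SE; apply: (@sdp_representationI R n void S 0 N N1 (fun _ _ => True)
  (fun _ => True) (fun z => 0 <= ga * z (inl None))).
- by move=> _; exact: representable_True.
- exact: representable_True.
- apply: representable_le.
  apply: affine_ext (affineM ga%:C (affine_var R (inl None))) => z.
  by rewrite rmorphM.
- move=> x; rewrite SE; split=> -[xp].
    by move=> h; split=> //; exists (fun=> 0).
  by move=> [y [_ _ h]].
Qed.

Lemma ratio_nat (R : realType) (p : int) (q : nat) (t : R) : (0 < q)%N ->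
  t = p%:~R / q%:R -> 0 <= t -> exists p' : nat, t = p'%:R / q%:R.
Proof.
move=> q0 tE t0; exists `|p|%N; rewrite tE; congr (_ / _).
have : 0 <= (p%:~R : R).
  by rewrite -(@pmulr_lge0 _ (q%:R)^-1) ?invr_gt0 ?ltr0n // -tE.
by rewrite ler0z => /gez0_abs {1}<-.
Qed.

Theorem theorem6 (R : realType) (n m : nat) (K : 'M[R[i]]_(n, m))
    (p : int) (q : nat) (t : R)
    (q_ge1 : (1 <= q)%N) (pq_coprime : coprimez p q%:Z)
    (t_def : t = p%:~R / q%:R)
    (t_range : -1 <= t <= 2) (t_neq0 : t != 0)
    (Upsilon_defined : t < 0 ->
       forall A : 'M[R[i]]_n, pdmx A -> K ^t* *m mxpowR A t *m K \in unitmx) :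
  (0 < t <= 1 ->
     exists2 k : nat, (k <= 2 * trunc_log 2 q + 1)%N &
       sdp_representation (hypograph (fun A => t * Upsilon K t A))
         (nseq k (2 * m * n)%N ++ [:: (m * n)%N; 1%N]))
  /\
  ((-1 <= t < 0) || (1 <= t <= 2) ->
     exists2 k : nat, (k <= 2 * trunc_log 2 q + 2)%N &
       sdp_representation (epigraph (fun A => t * Upsilon K t A))
         (nseq k (2 * m * n)%N ++ [:: (m * n)%N; 1%N])).
Proof.
have q0 : 0 < (q%:R : R) by rewrite ltr0n.
have [nm0|] := boolP ((n == 0)%N || (m == 0)%N).
  (* If a dimension is 0, the function vanishes and a scalar inequality on [tau] alone describes the
     set. *)
  have S0 A : t * Upsilon K t A = 0 by rewrite Upsilon_degenerate ?mulr0.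
  split=> _; exists 0%N => //.
    apply: (@sdp_degenerate _ _ _ _ _ (-1)) => x.
    by rewrite /hypograph S0 mulN1r oppr_ge0.
  apply: (@sdp_degenerate _ _ _ _ _ 1) => x.
  by rewrite /epigraph S0 mul1r.
rewrite negb_or -!lt0n => /andP[n0 m0]; split.
  move=> t01; have [t0 t1] := andP t01.
  have [p' tE] := ratio_nat q_ge1 t_def (ltW t0).
  have pq : (p' <= q)%N by move: t1; rewrite tE ler_pdivrMr // mul1r ler_nat.
  have [s [o [sz bnd att]]] := geomean_system R q_ge1 pq.
  rewrite -tE in bnd att.
  exists (size s + false)%N; first by rewrite addn0.
  (* Here [Z o] stands for [(1 (x) B) #_t (A (x) 1)], and the scalar inequality says that [tau] is
     at most its form at [vecc K] minus [(1 - t) tr B]. *)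
  apply: (@sdp_assembly _ _ _ K s o false false 1 (t - 1) (-1) 0) => //.
  move=> -[A tau].
  rewrite /hypograph /=; split=> -[Ap h]; split=> //.
    have [B [Z [Bh Bp [Zh Zs] [Z0 Z1] E]]] :=
      hypograph_complete K t_neq0 Ap t0 att.
    exists B, 0, Z; split => //.
    by rewrite -E; move: h; lra.
  case: h => B [c [Z [[Bh Bp] [Zh Zs] [Z0 Z1] _ h]]].
  have := hypograph_sound K n0 m0 Ap Bh Bp Zh Zs t01 bnd Z0 Z1.
  by move: h; lra.
case/orP=> [/andP[tm1 t0]|t12].
  have [p' tE] : exists p' : nat, - t = p'%:R / q%:R.
    apply: (@ratio_nat _ (- p) q) => //; last by rewrite oppr_ge0 ltW.
    by rewrite t_def rmorphN mulNr.
  have pq : (p' <= q)%N.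
    by move: tm1; rewrite lerNl tE ler_pdivrMr // mul1r ler_nat.
  have [s [o [sz bnd att]]] := geomean_system R q_ge1 pq.
  rewrite -tE in bnd att.
  exists (size s + true)%N; first by rewrite addn1 addn2 ltnS -addn1.
  (* For [t < 0] the bordered vector comes from [1 (x) B] and the mean has weight [-t]; the scalar
     inequality is [c - (1 - t) tr B <= tau]. *)
  apply: (@sdp_assembly _ _ _ K s o false true 0 (1 - t) 1 (-1)) => // -[A tau].
  rewrite /epigraph /=; split=> -[Ap h]; split=> //.
    have [B [Z [Bh Bp [Zh Zs] [Z0 Z1] E]]] :=
      epigraph_complete_neg t_neq0 Ap t0 (Upsilon_defined t0 A Ap) att.
    exists B, (t * Upsilon K t A + (1 - t) * complex.Re (\tr B)), Z.
    split => //.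
    by move: h; lra.
  case: h => B [c [Z [[Bh Bp] [Zh Zs] [Z0 Z1] E h]]].
  have := epigraph_sound_neg n0 m0 Ap Bh Bp Zh Zs t0 (Upsilon_defined t0 A Ap)
    bnd Z0 Z1 (E isT).
  by move: h; lra.
have [t1 t2] := andP t12.
have [p' tE] : exists p' : nat, t - 1 = p'%:R / q%:R.
  apply: (@ratio_nat _ (p - q%:Z) q) => //; last by rewrite subr_ge0.
  by rewrite t_def rmorphB /= mulrBl divff ?gt_eqF.
have pq : (p' <= q)%N.
  have : t - 1 <= 1 by lra.
  by rewrite tE ler_pdivrMr // mul1r ler_nat.
have [s [o [sz bnd att]]] := geomean_system R q_ge1 pq.
rewrite -tE in bnd att.
exists (size s + true)%N; first by rewrite addn1 addn2 ltnS -addn1.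
(* For [t >= 1] the bordered vector comes from [A (x) 1] and the mean has weight
   [t - 1 = (p - q) / q], of the same denominator. *)
apply: (@sdp_assembly _ _ _ K s o true true 0 (1 - t) 1 (-1)) => // -[A tau].
rewrite /epigraph /=; split=> -[Ap h]; split=> //.
  have [B [Z [Bh Bp [Zh Zs] [Z0 Z1] E]]] :=
    epigraph_complete_pos K t_neq0 Ap t1 att.
  exists B, (t * Upsilon K t A + (1 - t) * complex.Re (\tr B)), Z.
    split => //.
  by move: h; lra.
case: h => B [c [Z [[Bh Bp] [Zh Zs] [Z0 Z1] E h]]].
have := epigraph_sound_pos n0 m0 Ap Bh Bp Zh Zs t12 bnd Z0 Z1 (E isT).
by move: h; lra.
Qed.
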